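(* Let $N_1,\dots,N_s\ge2$ ($s\ge1$) be pairwise coprime integers generating the multiplicative monoid $\mathcal S$, and let $\mathcal M$ be either $M^0(\mathbb T)$ or $M^{\kappa_0}(\mathbb T)$. The map $\Phi_{\mathcal S}:H^0(\mathcal S,\mathcal M)\to Z(\mathcal S,\mathcal M)$ sending $\mu$ to $\Phi_{\mathcal S}(\mu)=\prod_{i=1}^s(1-N_i^* )\mu$ is (well defined and) injective. For $\mu\in H^0(\mathcal S,\mathcal M)$ we also have $\Phi_{\mathcal S}(\mu)=\Omega_{\mathcal S}\mu$. A measure $\mu\in H^0(\mathcal S,\mathcal M)$ is atomless if and only if $\Phi_{\mathcal S}(\mu)$ is atomless. The inclusion $Z(\mathcal S,\mathcal M)\hookrightarrow\mathcal M$ induces an isomorphism $Z(\mathcal S,\mathcal M)\cong\mathcal M/\mathcal M\mathcal S$ whose inverse map sends $\mu\bmod\mathcal M\mathcal S$ to $\Omega_{\mathcal S}\mu=\prod_{i=1}^s(1-e_i)\mu$. The subgroup $\mathcal M\mathcal S$ consists of the measures $\mu\in\mathcal M$ with $c_\nu(\mu)=0$ for all $\nu\in\mathbb Z$ such that $N_i\nmid\nu$ for all $1\le i\le s$.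
   Context: $\mathbb T$ is the unit circle with Haar probability measure $\lambda$, $\varphi_N(\zeta)=\zeta^N$, $\mathcal S=\{N_1^{\nu_1}\cdots N_s^{\nu_s}:\nu_i\ge0\}$. $M(\mathbb T)$ is the space of finite real Borel measures on $\mathbb T$, $M^0(\mathbb T)=\{\mu\in M(\mathbb T):\mu(\mathbb T)=0\}$ and $M^{\kappa_0}(\mathbb T)=\{\mu-\mu(\mathbb T)\lambda:\mu\in M(\mathbb T)\text{ singular to }\lambda\}$. $c_\nu(\mu)=\int_{\mathbb T}\zeta^{-\nu}d\mu(\zeta)$. $N_*\mu=(\varphi_N)_*\mu$; $(N^*\mu)(E)=\frac1N\sum_{k=0}^{N-1}\mu(\varphi_N(E\cap I_k))$ with $I_k=\{e^{i\theta}:\tfrac{2\pi k}N\le\theta<\tfrac{2\pi(k+1)}N\}$; $e_i\mu=\frac1{N_i}\sum_{\zeta^{N_i}=1}\zeta_*\mu$, where $\zeta_*$ is push-forward under rotation by $\zeta$ (the $e_i$ commute), and $\Omega_{\mathcal S}=\prod_{i=1}^s(1-e_i)$. $H^0(\mathcal S,\mathcal M)=\{\mu\in\mathcal M:N_*\mu=\mu\ \forall N\in\mathcal S\}$, $Z(\mathcal S,\mathcal M)=\{\mu\in\mathcal M:N_*\mu=0\ \forall N\in\mathcal S,\ N\ne1\}$, and $\mathcal M\mathcal S$ is the subgroup of $\mathcal M$ generated by all $N^*\mu$ with $\mu\in\mathcal M$, $N\in\mathcal S$, $N\ne1$ (equivalently $\mathcal M\mathcal S=N_1^*\mathcal M+\dots+N_s^*\mathcal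 M$). *)

(* Defs.v *)
From HB Require Import structures.
From mathcomp Require Import all_boot all_order all_algebra ring_quotient.
From mathcomp Require Import all_classical all_reals all_analysis measurable_realfun.
From mathcomp Require Import ring lra.
From mathcomp.real_closed Require Import complex.

Set Implicit Arguments.
Unset Strict Implicit.
Unset Printing Implicit Defensive.

Import Order.TTheory GRing.Theory Num.Theory numFieldNormedType.Exports.
Local Open Scope classical_set_scope.
Local Open Scope ring_scope.
Local Open Scope complex_scope.

Section circle.
Variable R : realType.
Local Notation C := (R[i]).

(* C^o (C as a normed module over itself) carries the usual topology of the
   complex numbers; set_type gives the unit circle the subspace topology. *)
Definition circle := set_type [set z : C^o | `|z| = 1].

HB.instance Definition _ :=
  Topological.copy circle (set_type [set z : C^o | `|z| = 1]).

Definition cval (z : circle) : C := set_val z.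

Definition mkcircle (z : C) (z1 : `|z| = 1) : circle :=
  @SigSub _ _ _ (z : C^o) (mem_set (z1 : [set z : C^o | `|z| = 1] z)).

Lemma cval_norm (z : circle) : `|cval z| = 1.
Proof. exact: (set_mem (valP z)). Qed.

Lemma cval_inj : injective cval. Proof. exact: val_inj. Qed.

Lemma cvalE z z1 : cval (@mkcircle z z1) = z. Proof. by []. Qed.

Lemma normC1 : `|1 : C| = 1. Proof. exact: normr1. Qed.

HB.instance Definition _ := isPointed.Build circle (mkcircle normC1).

HB.instance Definition _ := @isMeasurable.Build default_measure_display
  circle <<s @open circle >> (@sigma_algebra0 _ setT (@open circle))
  (@sigma_algebraC _ (@open circle))
  (@sigma_algebra_bigcup _ setT (@open circle)).

Lemma expi_norm (t : R) : `|cos t +i* sin t| = 1 :> C.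
Proof. by rewrite normc_def /= cos2Dsin2 sqrtr1. Qed.

Definition expi (t : R) : circle := mkcircle (expi_norm t).

Lemma crot_norm (w z : circle) : `|cval w * cval z| = 1.
Proof. by rewrite normrM !cval_norm mulr1. Qed.

Definition crot (w z : circle) : circle := mkcircle (crot_norm w z).

Lemma cpow_norm (n : nat) (z : circle) : `|cval z ^+ n| = 1.
Proof. by rewrite normrX cval_norm expr1n. Qed.

Definition cpow (n : nat) (z : circle) : circle := mkcircle (cpow_norm n z).

Lemma open_cval (U : set C^o) : open U -> open (cval @^-1` U : set circle).
Proof. by move=> oU; exists U. Qed.

Lemma continuous_circle (f : circle -> circle) (g : C^o -> C^o) :
  continuous g -> (forall z, cval (f z) = g (cval z)) -> measurable_fun setT f.
Proof.
move=> cg fg; apply: (@measurability _ _ _ _ _ _ (@open circle)) => //.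
move=> _ [_ [U oU <-] <-]; apply: measurableI => //; apply: sub_sigma_algebra.
exists (g @^-1` U); first exact: (iffLR (continuousP _) cg).
apply/seteqP; split=> z /=; rewrite -[set_val z]/(cval z) -fg //.
Qed.

Lemma measurable_crot w : measurable_fun setT (crot w).
Proof.
apply: (@continuous_circle _ (fun z => cval w * z)) => // z.
exact: mulrl_continuous.
Qed.

Lemma measurable_cpow n : measurable_fun setT (cpow n).
Proof.
apply: (@continuous_circle _ (fun z => (z : C) ^+ n)) => //.
elim: n => [|n IH] z.
  have -> : (fun z : C^o => (z : C) ^+ 0) = cst (1 : C^o) by apply/funext.
  exact: cst_continuous.
have -> : (fun z : C^o => (z : C) ^+ n.+1) = fun x : C^o => (x : C) * (x : C) ^+ n.
  by apply/funext => x; rewrite exprS.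
apply: (@continuousM C C^o id (fun x => (x : C) ^+ n) z); [move=> ?; exact|exact: IH].
Qed.

Lemma normcr (x : R) : `|x%:C| = `|x|%:C :> C.
Proof. by rewrite normc_def /= expr0n addr0 sqrtr_sqr. Qed.

Lemma normc_le_ReIm (z : C) : `|z| <= (`|complex.Re z| + `|complex.Im z|)%:C.
Proof.
rewrite {1}(complexE z) (le_trans (ler_normD _ _))// normrM !normcr.
by rewrite (_ : `|0 +i* 1| = 1 :> C) ?mul1r ?rmorphD// normc_def /= expr0n add0r expr1n sqrtr1.
Qed.

Lemma posC (e : C) : 0 < e -> e = (complex.Re e)%:C /\ 0 < complex.Re e.
Proof. by case: e => a b; rewrite ltcE /= => /andP[/eqP -> ->]. Qed.

Lemma continuous_complex (f g : R -> R) : continuous f -> continuous g ->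
  continuous ((fun t => f t +i* g t) : R -> C^o).
Proof.
move=> cf cg t; apply/cvgrPdist_le => /= e /posC[-> e0].
have e20 : 0 < complex.Re e / 2 by rewrite divr_gt0.
have /cvgrPdist_le/(_ _ e20) Hf := cf t.
have /cvgrPdist_le/(_ _ e20) Hg := cg t.
near=> s.
rewrite (le_trans (normc_le_ReIm _))// lecR /= [leRHS]splitr lerD//.
- by near: s.
- by near: s.
Unshelve. all: by end_near. Qed.

Lemma measurable_circle_open (U : set circle) : open U -> measurable U.
Proof. exact: sub_sigma_algebra. Qed.

Lemma measurable_expi : measurable_fun setT expi.
Proof.
apply: (@measurability _ _ _ _ _ _ (@open circle)) => //.
move=> _ [_ [U oU <-] <-]; apply: measurableI => //; apply: open_measurable.
apply: (iffLR (continuousP _)) oU.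
apply: continuous_complex; [exact: continuous_cos|exact: continuous_sin].
Qed.

Lemma measurable_circle_fun (f : C^o -> R) : continuous f ->
  measurable_fun setT (fun z => f (cval z)).
Proof.
move=> cf; apply: (measurability (@RGenOInfty.G R)) => [|_ [_ [r ->] <-]].
  exact: RGenOInfty.measurableE.
apply: measurableI => //; apply: measurable_circle_open.
exists (f @^-1` `]r, +oo[) => //.
by apply: (iffLR (continuousP _) cf); exact: interval_open.
Qed.

Lemma continuous_Re : continuous (@complex.Re R : C^o -> R).
Proof.
move=> z U /nbhs_ballP[e /= e0 eU].
apply/(@nbhs_ballP C C^o); exists e%:C => /=; first by rewrite ltcR.
move=> x; rewrite -ball_normE /= => xz; apply: eU.
by rewrite -ball_normE /= -raddfB -ltcR (le_lt_trans (normc_ge_Re _)).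
Qed.

Lemma normc_ge_Im (z : C) : `|complex.Im z|%:C <= `|z|.
Proof.
have -> : complex.Im z = complex.Re (- (0 +i* 1) * z) by case: z => a b /=; ring.
rewrite (le_trans (normc_ge_Re _))// normrM normrN.
by rewrite [X in X * _](_ : _ = 1) ?mul1r// normc_def /= expr0n add0r expr1n sqrtr1.
Qed.

Lemma continuous_Im : continuous (@complex.Im R : C^o -> R).
Proof.
move=> z U /nbhs_ballP[e /= e0 eU].
apply/(@nbhs_ballP C C^o); exists e%:C => /=; first by rewrite ltcR.
move=> x; rewrite -ball_normE /= => xz; apply: eU.
by rewrite -ball_normE /= -raddfB -ltcR (le_lt_trans (normc_ge_Im _)).
Qed.

HB.instance Definition _ w := isMeasurableFun.Build _ _ _ _ (crot w) (measurable_crot w).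
HB.instance Definition _ n := isMeasurableFun.Build _ _ _ _ (cpow n) (measurable_cpow n).
HB.instance Definition _ := isMeasurableFun.Build _ _ _ _ expi measurable_expi.
End circle.

Section arg.
Variable R : realType.
Implicit Types z w : circle R.

Definition argz z : R :=
  if 0 <= complex.Im (cval z) then acos (complex.Re (cval z))
  else pi *+ 2 - acos (complex.Re (cval z)).

Lemma circle_Re2Im2 z : complex.Re (cval z) ^+ 2 + complex.Im (cval z) ^+ 2 = 1.
Proof.
have := add_Re2_Im2 (cval z); rewrite cval_norm expr1n.
by case: z => [[a b] h] /= [].
Qed.

Lemma circle_Re_itv z : -1 <= complex.Re (cval z) <= 1.
Proof.
rewrite -ler_norml -(@expr_le1 _ 2)// -normrX ger0_norm ?sqr_ge0//.
by rewrite -(circle_Re2Im2 z) lerDl sqr_ge0.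
Qed.

Lemma argz_bound z : 0 <= argz z < pi *+ 2.
Proof.
have zR := circle_Re_itv z; have z2 := circle_Re2Im2 z.
have pi0 := pi_gt0 R; have a0 := acos_ge0 zR; have a1 := acos_lepi zR.
rewrite /argz; case: ifPn => Iz; first by rewrite a0 /= mulr2n; lra.
have : 0 < acos (complex.Re (cval z)).
  apply: acos_gt0; case/andP : zR => -> /=.
  rewrite le_eqVlt => /predU1P[R1|//]; move: z2 Iz; rewrite R1 expr1n => h.
  have /eqP : complex.Im (cval z) ^+ 2 = 0 by lra.
  by rewrite sqrf_eq0 => /eqP ->; rewrite lexx.
by rewrite mulr2n; lra.
Qed.

Lemma circle_eq z w : complex.Re (cval z) = complex.Re (cval w) ->
  complex.Im (cval z) = complex.Im (cval w) -> z = w.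
Proof.
move=> h1 h2; apply: cval_inj; move: h1 h2.
by case: (cval z) (cval w) => a b [c e] /= -> ->.
Qed.

Lemma argzK : cancel argz (@expi R).
Proof.
move=> z; have zR := circle_Re_itv z; have z2 := circle_Re2Im2 z.
have s2 : Num.sqrt (1 - complex.Re (cval z) ^+ 2) = `|complex.Im (cval z)|.
  by rewrite -sqrtr_sqr; congr Num.sqrt; lra.
rewrite /argz; case: ifPn => Iz; apply: circle_eq => /=.
- by rewrite acosK// in_itv.
- by rewrite sin_acos// s2 ger0_norm.
- by rewrite addrC cosD2pi cosN acosK// in_itv.
- by rewrite addrC sinD2pi sinN sin_acos// s2 ltr0_norm ?opprK// ltNge.
Qed.

Lemma expiK (t : R) : 0 <= t < pi *+ 2 -> argz (expi t) = t.
Proof.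
move=> /andP[t0 t2]; rewrite /argz /=; have pi0 := pi_gt0 R.
have [tpi|tpi] := leP t pi.
  by rewrite sin_ge0_pi ?t0//; apply: cosK; rewrite in_itv /= t0.
have st : sin t < 0.
  have : 0 < sin (t - pi) by apply: sin_gt0_pi; move: t2; rewrite mulr2n; lra.
  by rewrite -oppr_lt0 -sinDpi subrK.
rewrite leNgt st /= -(cosN t) -cosD2pi cosK; first by ring.
by rewrite in_itv /=; move: t2; rewrite mulr2n; lra.
Qed.

Lemma measurable_argz : measurable_fun setT argz.
Proof.
pose h (x : R) := acos (Num.max (-1) (Num.min 1 x)).
have hE z : acos (complex.Re (cval z)) = h (complex.Re (cval z)).
  by have /andP[h1 h2] := circle_Re_itv z; rewrite /h min_r// max_r.
have clip (x : R) : -1 <= Num.max (-1) (Num.min 1 x) <= 1.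
  by rewrite le_max lexx /= ge_max ge_min lexx /= andbT; lra.
have mh : measurable_fun setT h.
  apply: nonincreasing_measurable => // x y xy; rewrite leNgt; apply/negP.
  rewrite -ltr_cos ?in_itv/= ?acos_ge0 ?acos_lepi ?acosK ?in_itv//=.
  by apply/negP; rewrite -leNgt; apply: le_max2 => //; apply: le_min2.
have mRe := measurable_circle_fun (@continuous_Re R).
have mIm := measurable_circle_fun (@continuous_Im R).
have mhR : measurable_fun setT (fun z => acos (complex.Re (cval z))).
  by under eq_fun do rewrite hE; apply: measurableT_comp mh mRe.
apply: measurable_fun_if => //.
- exact: measurable_fun_ler.
- exact: measurable_funS mhR.
- by apply: measurable_funS (measurable_funB _ mhR).
Qed.

Lemma measurable_circle_set1 z : measurable [set z].
Proof.
have -> : [set z] = [set w | complex.Re (cval w) = complex.Re (cval z)] `&`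
                    [set w | complex.Im (cval w) = complex.Im (cval z)].
  by apply/seteqP; split => w /=; [move=> ->|case; exact: circle_eq].
apply: measurableI.
  have := @measurable_circle_fun R _ (@continuous_Re R) measurableT _
    (measurable_set1 (complex.Re (cval z))).
  by rewrite setTI.
have := @measurable_circle_fun R _ (@continuous_Im R) measurableT _
  (measurable_set1 (complex.Im (cval z))).
by rewrite setTI.
Qed.

Lemma expiDn (t : R) (n : nat) : expi (t + (pi *+ 2) *+ n) = expi t.
Proof.
apply: circle_eq => /=; rewrite periodicn//; [exact: cosD2pi|exact: sinD2pi].
Qed.

Lemma cpow_expi n (t : R) : cpow n (expi t) = expi (n%:R * t).
Proof.
apply: cval_inj; rewrite !cvalE; elim: n => [|n IH].
  by rewrite mul0r cos0 sin0 expr0.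
rewrite exprS IH -natr1 mulrDl mul1r addrC cosD sinD; simpc.
by congr (_ +i* _); ring.
Qed.

Definition sector (n k : nat) : set (circle R) :=
  [set expi t | t in `[(2 * pi * k%:R / n%:R), (2 * pi * k.+1%:R / n%:R)[].

(* The inverse of z |-> z ^+ n on sector n k, see cpow_sector. *)
Definition branch (n k : nat) z : circle R :=
  expi ((argz z + 2 * pi * k%:R) / n%:R).

Lemma measurable_branch n k : measurable_fun setT (branch n k).
Proof.
apply: measurableT_comp; first exact: measurable_expi.
by apply: measurable_funM => //; apply: measurable_funD => //; exact: measurable_argz.
Qed.

HB.instance Definition _ n k :=
  isMeasurableFun.Build _ _ _ _ (branch n k) (measurable_branch n k).

Lemma cpow_sector n k E : (0 < n)%N ->
  cpow n @` (E `&` sector n k) = branch n k @^-1` E.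
Proof.
move=> n0; have nR0 : 0 < n%:R :> R by rewrite ltr0n.
have piN : 2 * pi * k%:R = (pi *+ 2) *+ k :> R by rewrite -mulr_natr -(mulr_natr pi); ring.
apply/seteqP; split => z /=.
- move=> [w [Ew [t /= + tw]] <-]; rewrite in_itv /= -tw in Ew *.
  rewrite ler_pdivrMr// ltr_pdivlMr// -natr1 => /andP[t1 t2].
  rewrite cpow_expi /branch.
  have -> : n%:R * t = (n%:R * t - 2 * pi * k%:R) + (pi *+ 2) *+ k.
    by rewrite -piN subrK.
  rewrite expiDn expiK; last by rewrite mulr2n; lra.
  by rewrite subrK mulrC mulKf// gt_eqF.
- move=> Eb; have /andP[a0 a2] := argz_bound z.
  exists (branch n k z).
    split => //; exists ((argz z + 2 * pi * k%:R) / n%:R) => //=.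
    rewrite in_itv /= ler_pM2r ?ltr_pM2r ?invr_gt0// -natr1.
    by move: a2; rewrite mulr2n; lra.
  rewrite cpow_expi mulrCA divff ?gt_eqF// mulr1 piN expiDn.
  exact: argzK.
Qed.

End arg.

Section real_measures.
Context d (T : measurableType d) (R : realType).
Implicit Types c : {charge set T -> \bar R}.

(* A charge of the library is a finite signed measure, but as a function on all
   of set T it has arbitrary values on non-measurable sets. Normalizing these
   to 0 makes Leibniz equality of rmeasure equality on measurable sets
   (rmeasureP), so that the finite real measures form a vector space. *)
Record rmeasure := Rmeasure {
  rcharge :> {charge set T -> \bar R} ;
  _ : forall A, ~ measurable A -> rcharge A = 0%E }.

Lemma charge_eq c1 c2 : c1 = c2 :> (set T -> \bar R) -> c1 = c2.
Proof.
case: c1 c2 => [f1 [[a1] [b1] [e1]]] [f2 [[a2] [b2] [e2]]] /= f12.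
subst f2; rewrite (Prop_irrelevance a1 a2) (Prop_irrelevance b1 b2).
by rewrite (Prop_irrelevance e1 e2).
Qed.

Lemma rmeasure_out (mu : rmeasure) A : ~ measurable A -> mu A = 0%E.
Proof. by case: mu => c h /=; exact: h. Qed.

Lemma rmeasureP (mu nu : rmeasure) :
  (forall A, measurable A -> mu A = nu A) -> mu = nu.
Proof.
move=> h; have : rcharge mu = rcharge nu.
  apply: charge_eq; apply/funext => A; have [/h//|nA] := pselect (measurable A).
  by rewrite !rmeasure_out.
case: mu nu h => [c1 h1] [c2 h2] _ /= c12; subst c2.
by congr Rmeasure; exact: Prop_irrelevance.
Qed.

Lemma crestr0_out c A : ~ measurable A ->
  crestr0 c (@measurableT _ T) A = 0%E.
Proof. by move=> nA; rewrite /crestr0 memNset. Qed.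

Definition rmeasure_of c : rmeasure :=
  @Rmeasure (crestr0 c measurableT) (@crestr0_out c).

Lemma rmeasure_ofE c A : measurable A -> rmeasure_of c A = c A.
Proof. by move=> mA; rewrite /= /crestr0 mem_set//= /crestr setIT. Qed.

HB.instance Definition _ := gen_eqMixin rmeasure.
HB.instance Definition _ := gen_choiceMixin rmeasure.

Definition radd (mu nu : rmeasure) := rmeasure_of (cadd mu nu).
Definition ropp (mu : rmeasure) := rmeasure_of (copp mu).
Definition rzero := rmeasure_of czero.
Definition rscale (a : R) (mu : rmeasure) := rmeasure_of (cscale a mu).

Let raddA : associative radd.
Proof. by move=> x y z; apply: rmeasureP => A mA; rewrite !rmeasure_ofE//= /cadd !rmeasure_ofE//= addeA. Qed.
Let raddC : commutative radd.
Proof. by move=> x y; apply: rmeasureP => A mA; rewrite !rmeasure_ofE//= /cadd addeC. Qed.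
Let radd0 : left_id rzero radd.
Proof. by move=> x; apply: rmeasureP => A mA; rewrite !rmeasure_ofE//= /cadd rmeasure_ofE//= add0e. Qed.
Let raddN : left_inverse rzero ropp radd.
Proof.
move=> x; apply: rmeasureP => A mA; rewrite !rmeasure_ofE//= /cadd rmeasure_ofE//=.
by rewrite /copp addeC subee// fin_num_measure.
Qed.
HB.instance Definition _ := GRing.isZmodule.Build rmeasure raddA raddC radd0 raddN.

Lemma rmeasureD (mu nu : rmeasure) A : measurable A -> (mu + nu)%R A = (mu A + nu A)%E.
Proof. by move=> mA; rewrite [LHS]rmeasure_ofE. Qed.
Lemma rmeasureN (mu : rmeasure) A : measurable A -> (- mu)%R A = (- mu A)%E.
Proof. by move=> mA; rewrite [LHS]rmeasure_ofE. Qed.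
Lemma rmeasure0 A : (0%R : rmeasure) A = 0%E.
Proof.
have [mA|nA] := pselect (measurable A); last exact: rmeasure_out.
by rewrite [LHS]rmeasure_ofE.
Qed.

Let scalerA a b mu : rscale a (rscale b mu) = rscale (a * b) mu.
Proof. by apply: rmeasureP => A mA; rewrite !rmeasure_ofE//= /cscale rmeasure_ofE//= /cscale EFinM muleA. Qed.
Let scaler1 : left_id 1 rscale.
Proof. by move=> mu; apply: rmeasureP => A mA; rewrite !rmeasure_ofE//= /cscale mul1e. Qed.
Let scalerDr : right_distributive rscale +%R.
Proof.
move=> a mu nu; apply: rmeasureP => A mA.
rewrite rmeasureD// !rmeasure_ofE//= /cscale rmeasureD// muleDr//.
by rewrite fin_num_adde_defl// fin_num_measure.
Qed.
Let scalerDl mu : {morph rscale^~ mu : a b / a + b}.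
Proof.
move=> a b; apply: rmeasureP => A mA.
rewrite rmeasureD// !rmeasure_ofE//= /cscale.
by rewrite -(fineK (fin_num_measure mu A mA)) -!EFinM -EFinD mulrDl.
Qed.
HB.instance Definition _ :=
  GRing.Zmodule_isLmodule.Build R rmeasure scalerA scaler1 scalerDr scalerDl.

Lemma rmeasureZ a (mu : rmeasure) A : measurable A -> (a *: mu)%R A = (a%:E * mu A)%E.
Proof. by move=> mA; rewrite [LHS]rmeasure_ofE. Qed.

Lemma rmeasureB (mu nu : rmeasure) A : measurable A -> (mu - nu)%R A = (mu A - nu A)%E.
Proof. by move=> mA; rewrite rmeasureD// rmeasureN. Qed.

Definition hahn_pos c : set T := sval (cid (Hahn_decomposition c)).
Definition hahn_neg c : set T := sval (cid (svalP (cid (Hahn_decomposition c)))).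
Definition hahnP c : hahn_decomposition c (hahn_pos c) (hahn_neg c) :=
  svalP (cid (svalP (cid (Hahn_decomposition c)))).

(* The value does not depend on the chosen Hahn decomposition. *)
Definition charge_integral c (f : T -> R) : R :=
  (\int[jordan_pos (hahnP c)]_x f x - \int[jordan_neg (hahnP c)]_x f x)%R.

(* pushforward, with the measurability of f bundled so that the charge structure
   can be inferred *)
Definition cpush (f : {mfun T >-> T}) c : set T -> \bar R := pushforward c f.

Section cpush.
Variables (f : {mfun T >-> T}) (c : {charge set T -> \bar R}).

Let cpushP : exists c' : {charge set T -> \bar R}, c' = cpush f c :> (set T -> _).
Proof.
have mf : measurable_fun [set: T] f by [].
by unshelve eexists (pushforward c f).
Qed.

Let cpush0 : cpush f c set0 = 0%E.
Proof. by have [c' <-] := cpushP; exact: charge0. Qed.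

Let cpush_fin A : measurable A -> cpush f c A \is a fin_num.
Proof. by have [c' <-] := cpushP; exact: fin_num_measure. Qed.

Let cpush_sigma : semi_sigma_additive (cpush f c).
Proof. by have [c' <-] := cpushP; exact: charge_semi_sigma_additive. Qed.

HB.instance Definition _ :=
  isCharge.Build _ _ _ (cpush f c) cpush0 cpush_fin cpush_sigma.

End cpush.

Definition rpush (f : {mfun T >-> T}) (mu : rmeasure) : rmeasure :=
  rmeasure_of (cpush f mu).

Lemma rpushE f mu A : measurable A -> rpush f mu A = mu (f @^-1` A).
Proof. by move=> mA; rewrite rmeasure_ofE. Qed.

Definition atomless (mu : rmeasure) := forall x, mu [set x] = 0%E.

(* Equivalently, the total variation of mu vanishes on ~` A. *)
Definition concentrated (mu : rmeasure) (A : set T) :=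
  forall B, measurable B -> B `<=` ~` A -> mu B = 0%E.

Definition mutually_singular (mu : rmeasure) (m : {measure set T -> \bar R}) :=
  exists A, [/\ measurable A, m A = 0%E & concentrated mu A].

Lemma mutually_singular0 m : mutually_singular 0 m.
Proof. by exists set0; split=> // B _ _; rewrite rmeasure0. Qed.

Lemma mutually_singularB mu nu m : mutually_singular mu m ->
  mutually_singular nu m -> mutually_singular (mu - nu) m.
Proof.
move=> [A [mA mA0 muA]] [B [mB mB0 nuB]]; exists (A `|` B); split.
- exact: measurableU.
- have mAB : (m A + m B = 0)%E by rewrite mA0 mB0 adde0.
  apply/eqP; rewrite -measure_le0; apply: le_trans (measureU2 m mA mB) _.
  by rewrite le_eqVlt; apply/orP; left; apply/eqP; exact: mAB.
- move=> D mD; rewrite setCU subsetI => -[DA DB].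
  by rewrite rmeasureB// muA// nuB// sube0.
Qed.

Lemma sum_charge n (F : 'I_n -> {charge set T -> \bar R}) :
  {c : {charge set T -> \bar R} | forall A, c A = (\sum_(k < n) F k A)%E}.
Proof.
elim: n F => [|n IH] F; first by exists czero => A; rewrite big_ord0.
have [c cE] := IH (fun k => F (widen_ord (leqnSn n) k)).
by exists (cadd c (F ord_max)) => A; rewrite big_ord_recr/= /cadd cE.
Qed.

End real_measures.
Arguments rmeasure {d} T R.

Section circle_measures.
Variable R : realType.
Local Notation C := (R[i]).
Local Notation T := (circle R).
Local Notation M := (rmeasure (circle R) R).
Implicit Types mu : M.

Lemma pi2_gt0 : (0 : R) < pi *+ 2.
Proof. by rewrite mulrn_wgt0// pi_gt0. Qed.

(* expi on the measurable type that carries Lebesgue measure in the library *)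
Definition expiT : measurableTypeR R -> T := @expi R.

HB.instance Definition _ :=
  isMeasurableFun.Build _ _ (measurableTypeR R) T expiT (@measurable_expi R).

(* Haar measure as normalized arc length *)
Definition haar : probability T R := distribution (uniform_prob pi2_gt0) expiT.

Definition haarM : M := rmeasure_of (charge_of_finite_measure haar).

Definition fourier_coef (nu : int) mu : C :=
  charge_integral mu (fun z => complex.Re (cval z ^ (- nu))) +i*
  charge_integral mu (fun z => complex.Im (cval z ^ (- nu))).

(* z |-> z ^+ n is injective on each sector, with a Borel inverse (cpow_sector):
   this is what makes the set function below a charge. It is 0 when n = 0. *)
Definition pullback_fun (n : nat) mu (E : set T) : \bar R :=
  ((n%:R^-1)%:E * \sum_(k < n) mu (cpow n @` (E `&` sector n k)))%E.

Section pullback.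
Variables (n : nat) (mu : M).

Let pullbackP : {c : {charge set T -> \bar R} | c = pullback_fun n mu :> (set T -> _)}.
Proof.
have [c cE] := sum_charge (fun k : 'I_n =>
  [the {charge set T -> \bar R} of cpush (branch n k) mu]).
exists (cscale n%:R^-1 c); apply/funext => E; rewrite /= /cscale cE.
congr (_ * _)%E; apply: eq_bigr => k _; rewrite cpow_sector//.
by apply: leq_trans (ltn_ord k).
Qed.

Let pullback0 : pullback_fun n mu set0 = 0%E.
Proof. by case: pullbackP => c <-; exact: charge0. Qed.

Let pullback_fin A : measurable A -> pullback_fun n mu A \is a fin_num.
Proof. by case: pullbackP => c <-; exact: fin_num_measure. Qed.

Let pullback_sigma : semi_sigma_additive (pullback_fun n mu).
Proof. by case: pullbackP => c <-; exact: charge_semi_sigma_additive. Qed.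

HB.instance Definition _ := isCharge.Build _ _ _
  (pullback_fun n mu) pullback0 pullback_fin pullback_sigma.

End pullback.

Definition pullback n mu : M := rmeasure_of (pullback_fun n mu).

Definition push n mu : M := rpush (cpow n) mu.

(* The index set of the sum is finite when 0 < n. *)
Definition average n mu : M :=
  n%:R^-1 *: \sum_(z \in [set z : T | cval z ^+ n = 1]) rpush (crot z) mu.

Definition M0 : {pred M} := [pred mu : M | `[< mu setT = 0%E >]].

Definition Mk0 : {pred M} := [pred mu : M | `[< exists2 sigma : M,
  mutually_singular sigma haar & mu = sigma - fine (sigma setT) *: haarM >]].

Lemma M0_zmod_closed : zmod_closed M0.
Proof.
split=> [|mu nu]; rewrite !inE.
  exact: rmeasure0.
move=> mu0 nu0.
by rewrite rmeasureB// mu0 nu0 sube0.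
Qed.
HB.instance Definition _ := GRing.isZmodClosed.Build M M0 M0_zmod_closed.

Lemma Mk0_zmod_closed : zmod_closed Mk0.
Proof.
split=> [|mu nu]; rewrite !inE.
  exists 0; last by rewrite rmeasure0 scale0r subr0.
  exact: mutually_singular0.
move=> [s1 sing1 ->] [s2 sing2 ->]; exists (s1 - s2).
  exact: mutually_singularB.
rewrite rmeasureB// fineB ?fin_num_measure// scalerBl.
by rewrite !opprD !opprK addrACA.
Qed.
HB.instance Definition _ := GRing.isZmodClosed.Build M Mk0 Mk0_zmod_closed.

End circle_measures.
Arguments M0 R : clear implicits.
Arguments Mk0 R : clear implicits.

Section subgroups.
Variable V : zmodType.

Record subgroup (P : zmodClosed V) := Subgroup { sg_val : V ; _ : sg_val \in P }.

Variable P : zmodClosed V.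
HB.instance Definition _ := [isSub for @sg_val P].
HB.instance Definition _ := [Choice of subgroup P by <:].
HB.instance Definition _ := [SubChoice_isSubZmodule of subgroup P by <:].

Definition generated (G : set V) : {pred V} := [pred v : V |
  `[< forall A : zmodClosed V, (forall g, G g -> g \in A) -> v \in A >]].

Lemma generated_zmod_closed G : zmod_closed (generated G).
Proof.
split=> [|u v]; rewrite !inE.
  by move=> A _; exact: rpred0.
by move=> Gu Gv A GA; rewrite rpredB ?Gu ?Gv.
Qed.
HB.instance Definition _ G :=
  GRing.isZmodClosed.Build V (generated G) (generated_zmod_closed G).

Definition relsub (Q : zmodClosed V) :
  {pred subgroup P} := [pred x : subgroup P | val x \in Q].

Lemma relsub_zmod_closed Q : zmod_closed (relsub Q).
Proof. by split=> [|u v]; rewrite !inE ?raddf0 ?rpred0// => uQ vQ; rewrite raddfB rpredB. Qed.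
HB.instance Definition _ Q :=
  GRing.isZmodClosed.Build (subgroup P) (relsub Q) (relsub_zmod_closed Q).

End subgroups.
Arguments relsub {V} P Q.

Section cohomology.
Variable R : realType.
Local Notation M := (rmeasure (circle R) R).
Variables (S : set nat) (cM : zmodClosed M).
Implicit Types mu : M.

Lemma push_is_zmod_morphism n : zmod_morphism (@push R n).
Proof.
move=> mu nu; apply: rmeasureP => A mA.
have mB : measurable (cpow n @^-1` A : set (circle R)) by exact: measurable_funPTI.
by rewrite rmeasureB// !rpushE// rmeasureB.
Qed.
HB.instance Definition _ n :=
  GRing.isZmodMorphism.Build M M (@push R n) (push_is_zmod_morphism n).

Definition H0S : {pred M} := [pred mu : M | (mu \in cM) &&
  `[< forall n, S n -> push n mu = mu >]].

Definition ZS : {pred M} := [pred mu : M | (mu \in cM) &&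
  `[< forall n, S n -> n <> 1%N -> push n mu = 0 >]].

Lemma ZS_zmod_closed : zmod_closed ZS.
Proof.
split=> [|mu nu]; rewrite !inE.
  by rewrite rpred0; apply/asboolP => n _ _; rewrite raddf0.
move=> /andP[mM /asboolP mZ] /andP[nM /asboolP nZ]; rewrite rpredB//=.
by apply/asboolP => n Sn n1; rewrite raddfB /= mZ// nZ// subr0.
Qed.
HB.instance Definition _ := GRing.isZmodClosed.Build M ZS ZS_zmod_closed.

Lemma ZS_sub mu : mu \in ZS -> mu \in cM.
Proof. by move=> /andP[]. Qed.

Definition MS : {pred M} := generated
  [set nu | exists n mu, [/\ S n, n <> 1%N, mu \in cM & nu = pullback n mu]].
HB.instance Definition _ := GRing.ZmodClosed.on MS.

Definition ZS_incl (z : subgroup ZS) : subgroup cM := Subgroup (ZS_sub (valP z)).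

(* Despite its name, ideal_quot applies to any subgroup of an abelian group. *)
Definition MmodMS := {ideal_quot (relsub cM MS)}.
HB.instance Definition _ := GRing.Zmodule.on MmodMS.

Definition coset_MS (mu : subgroup cM) : MmodMS :=
  (\pi_({ideal_quot (relsub cM MS)}) mu)%qT.

End cohomology.

Section main_maps.
Variables (R : realType) (s : nat) (N : 'I_s -> nat).
Local Notation M := (rmeasure (circle R) R).

Definition generated_monoid : set nat :=
  [set n | exists nu : 'I_s -> nat, n = (\prod_(i < s) N i ^ nu i)%N].

(* The factors of each of these two products commute when the N i are pairwise
   coprime, so the order of composition does not matter. *)
Definition Phi : M -> M :=
  \big[comp/idfun]_(i < s) (fun mu => mu - pullback (N i) mu).

Definition Omega : M -> M :=
  \big[comp/idfun]_(i < s) (fun mu => mu - average (N i) mu).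

End main_maps.

(* Main.v *)
Require Import Defs.
From HB Require Import structures.
From mathcomp Require Import all_boot all_order all_algebra ring_quotient.
From mathcomp Require Import all_classical all_reals all_analysis measurable_realfun.
From mathcomp Require Import ring lra.
From mathcomp.real_closed Require Import complex.

Set Implicit Arguments.
Unset Strict Implicit.
Unset Printing Implicit Defensive.

Import Order.TTheory GRing.Theory Num.Theory numFieldNormedType.Exports.
Local Open Scope classical_set_scope.
Local Open Scope ring_scope.

(* A measure on the circle is determined by its Fourier coefficients. On
   coefficients, push-forward along z^n reads nu -> n nu, pull-back reads
   nu -> nu / n (and 0 when n does not divide nu), and e_i kills the nu that are
   not multiples of N_i. Hence N_* N^* = 1, N^* N_* = e_N, and the operators
   attached to coprime integers commute, which makes the algebraic part of the
   corollary formal: e_i = N_i^* on N_*-invariant measures, Omega kills each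
   N_i^* M, fixes Z, and differs from the identity by elements of MS.

   Uniqueness: if all coefficients of mu vanish, the bounded functions h such
   that multiplication by h preserves the g with all coefficients of g mu equal
   to 0 form an algebra containing cos and sin and closed under bounded
   pointwise limits; the sets whose indicators lie in it form a sigma-algebra
   containing the half-planes, hence all Borel sets.

   Stability of M^kappa0 follows from invariance of Haar measure, and the
   assertion on atoms from (N^* mu){z} = mu{z^N} / N. *)

(** * Bounded measurable test functions *)

Section bounded_measurable.
Context d (T : measurableType d) (R : realType).
Implicit Types f g : T -> R.

(** Boundedness makes these functions integrable for every finite measure and keeps the class closed
    under products. *)
Definition bmeasurable f :=
  measurable_fun setT f /\ exists M, forall x, `|f x| <= M.

Lemma bmeasurable_cst (a : R) : bmeasurable (fun=> a).
Proof. by split; [exact: measurable_cst|exists `|a|]. Qed.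

Lemma bmeasurableD f g : bmeasurable f -> bmeasurable g ->
  bmeasurable (fun x => f x + g x).
Proof.
move=> [mf [a fa]] [mg [b gb]]; split; first exact: measurable_funD.
by exists (a + b) => x; rewrite (le_trans (ler_normD _ _))// lerD.
Qed.

Lemma bmeasurableM f g : bmeasurable f -> bmeasurable g ->
  bmeasurable (fun x => f x * g x).
Proof.
move=> [mf [a fa]] [mg [b gb]]; split; first exact: measurable_funM.
by exists (a * b) => x; rewrite normrM ler_pM.
Qed.

Lemma bmeasurableZ (a : R) f : bmeasurable f -> bmeasurable (fun x => a * f x).
Proof. by move=> bf; apply: bmeasurableM => //; exact: bmeasurable_cst. Qed.

Lemma bmeasurable_comp f (h : {mfun T >-> T}) :
  bmeasurable f -> bmeasurable (fun x => f (h x)).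
Proof.
move=> [mf [a fa]]; split; last by exists a.
exact: measurableT_comp.
Qed.

Lemma bmeasurable_integrable (m : {measure set T -> \bar R}) f :
  (m setT < +oo)%E -> bmeasurable f -> m.-integrable setT (EFin \o f).
Proof.
move=> mfin [mf [a fa]]; apply: measurable_bounded_integrable => //.
exists a; split; first exact: num_real.
by move=> b ab x _ /=; rewrite (le_trans (fa x))// ltW.
Qed.

End bounded_measurable.

(** * Integration against a signed measure *)

Section charge_integral.
Context d (T : measurableType d) (R : realType).
Implicit Types (mu nu : rmeasure T R) (f g : T -> R).

Lemma Rintegral_measure_add (m1 m2 : {measure set T -> \bar R}) f :
  (m1 setT < +oo)%E -> (m2 setT < +oo)%E -> bmeasurable f ->
  (\int[measure_add m1 m2]_x f x = \int[m1]_x f x + \int[m2]_x f x)%R.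
Proof.
move=> m1fin m2fin bf; have i1 := bmeasurable_integrable m1fin bf.
have i2 := bmeasurable_integrable m2fin bf.
rewrite /Rintegral (integral_measure_add measurableT i1 i2).
by rewrite fineD//; exact: integrable_fin_num.
Qed.

Lemma jordan_decompE mu A : measurable A ->
  mu A = (jordan_pos (hahnP mu) A - jordan_neg (hahnP mu) A)%E.
Proof. by move=> mA; rewrite (jordan_decomp (hahnP mu) mA) /cadd /= cscaleN1. Qed.

Let jfin (m : {finite_measure set T -> \bar R}) : (m setT < +oo)%E.
Proof. by rewrite ltey_eq fin_num_measure. Qed.

Let jint (m : {finite_measure set T -> \bar R}) f :
  bmeasurable f -> m.-integrable setT (EFin \o f).
Proof. by move=> bf; apply: bmeasurable_integrable bf; exact: jfin. Qed.

(** Moving the negative parts across turns [p - n = m1 - m2] into [p + m2 = m1 + n], an equality of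
    positive measures, whose integrals can be compared directly. *)
Lemma charge_integral_diff mu (m1 m2 : {measure set T -> \bar R}) f :
  (m1 setT < +oo)%E -> (m2 setT < +oo)%E ->
  (forall A, measurable A -> mu A = (m1 A - m2 A)%E) -> bmeasurable f ->
  charge_integral mu f = (\int[m1]_x f x - \int[m2]_x f x)%R.
Proof.
move=> m1fin m2fin mu12 bf; rewrite /charge_integral.
set p := jordan_pos _; set n := jordan_neg _.
have fin (m : {measure set T -> \bar R}) A :
    measurable A -> (m setT < +oo)%E -> m A \is a fin_num.
  move=> mA mfin; rewrite ge0_fin_numE ?measure_ge0//.
  by apply: le_lt_trans mfin; rewrite le_measure ?inE.
apply/eqP; rewrite subr_eq addrAC eq_sym subr_eq eq_sym; apply/eqP.
rewrite -(Rintegral_measure_add (jfin p) m2fin bf) -(Rintegral_measure_add m1fin (jfin n) bf).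
congr fine.
apply: eq_measure_integral => A mA _; rewrite [LHS]measure_addE [RHS]measure_addE.
have := mu12 A mA; rewrite jordan_decompE//.
have key (a b c e : \bar R) : a \is a fin_num -> b \is a fin_num ->
    c \is a fin_num -> e \is a fin_num -> (a - b = c - e -> a + e = c + b)%E.
  move=> /fineK <- /fineK <- /fineK <- /fineK <-; rewrite -!EFinB -!EFinD.
  by case=> h; congr EFin; lra.
by apply: key; apply: fin => //; exact: jfin.
Qed.

Lemma charge_integralDr mu f g : bmeasurable f -> bmeasurable g ->
  charge_integral mu (fun x => f x + g x) =
  charge_integral mu f + charge_integral mu g.
Proof.
move=> bf bg; rewrite /charge_integral !RintegralD//; try exact: jint.
by rewrite opprD addrACA.
Qed.

Lemma charge_integralZr mu a f : bmeasurable f ->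
  charge_integral mu (fun x => a * f x) = a * charge_integral mu f.
Proof.
move=> bf; rewrite /charge_integral !RintegralZl//; try exact: jint.
by rewrite mulrBr.
Qed.

Lemma charge_integral_lin mu a b f g : bmeasurable f -> bmeasurable g ->
  charge_integral mu (fun x => a * f x + b * g x) =
  a * charge_integral mu f + b * charge_integral mu g.
Proof.
move=> bf bg; rewrite charge_integralDr; [|exact: bmeasurableZ..].
by rewrite !charge_integralZr.
Qed.

Lemma charge_integral_cst mu a :
  charge_integral mu (fun=> a) = a * fine (mu setT).
Proof.
rewrite /charge_integral !Rintegral_cst// jordan_decompE// fineB ?fin_num_measure//.
by rewrite mulrBr.
Qed.

(** The Jordan parts of [mu - nu] need not be built from those of [mu] and [nu]. Independence of the
    decomposition allows the positive part of [mu] plus the negative part of [nu] to be used, and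
    symmetrically. *)
Lemma charge_integralB mu nu f : bmeasurable f ->
  charge_integral (mu - nu) f = charge_integral mu f - charge_integral nu f.
Proof.
move=> bf.
rewrite (@charge_integral_diff _
  (measure_add (jordan_pos (hahnP mu)) (jordan_neg (hahnP nu)))
  (measure_add (jordan_neg (hahnP mu)) (jordan_pos (hahnP nu)))) //.
- have key (a b c e : R) : a + e - (b + c) = (a - b) - (c - e) by ring.
  by rewrite !Rintegral_measure_add; try exact: jfin; try exact: key.
- by rewrite [ltLHS]measure_addE lte_add_pinfty; try exact: jfin.
- by rewrite [ltLHS]measure_addE lte_add_pinfty; try exact: jfin.
- move=> A mA; rewrite rmeasureB// !jordan_decompE//.
  have key (a b c e : \bar R) : a \is a fin_num -> b \is a fin_num ->
      c \is a fin_num -> e \is a fin_num -> (a - b - (c - e) = a + e - (b + c))%E.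
    by move: a b c e => [a| |] [b| |] [c| |] [e| |] // _ _ _ _; congr EFin; ring.
  rewrite -[LHS]/(_ - _ - (_ - _))%E key; try exact: fin_num_measure.
  by congr (_ - _)%E; apply/esym/measure_addE.
Qed.

(** Bundling the integral as an additive map makes the generic lemmas on sums and integer multiples
    available. *)
Lemma charge_integral_additive f : bmeasurable f ->
  exists L : {additive rmeasure T R -> R}, forall mu, charge_integral mu f = L mu.
Proof.
move=> bf; pose l mu := charge_integral mu f.
have lB : zmod_morphism l by move=> mu nu; exact: charge_integralB.
pose L : {additive rmeasure T R -> R} :=
  HB.pack l (GRing.isZmodMorphism.Build _ _ l lB).
by exists L.
Qed.

Lemma charge_integral_sum (n : nat) (mu_ : 'I_n -> rmeasure T R) f : bmeasurable f ->
  charge_integral (\sum_(k < n) mu_ k) f = \sum_(k < n) charge_integral (mu_ k) f.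
Proof.
move=> /charge_integral_additive[L LE]; rewrite LE raddf_sum.
by apply: eq_bigr => k _; rewrite LE.
Qed.

(** Additivity suffices, because [mu] is [n] times [n%:R^-1 *: mu]. For [n = 0] both sides vanish,
    the inverse of 0 being 0. *)
Lemma charge_integralV mu (n : nat) f : bmeasurable f ->
  charge_integral (n%:R^-1 *: mu) f = n%:R^-1 * charge_integral mu f.
Proof.
move=> /charge_integral_additive[L LE]; rewrite !LE.
have [->|n0] := eqVneq n 0%N; first by rewrite invr0 scale0r raddf0 mul0r.
have nR0 : n%:R != 0 :> R by rewrite pnatr_eq0.
rewrite -[in RHS](scalerKV nR0 mu) scaler_nat raddfMn.
by rewrite -[L _ *+ n]mulr_natl mulKf.
Qed.

Lemma charge_integral_push mu (h : {mfun T >-> T}) f : bmeasurable f ->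
  charge_integral (rpush h mu) f = charge_integral mu (fun x => f (h x)).
Proof.
move=> bf; have mh : measurable_fun [set: T] h by [].
rewrite (@charge_integral_diff _
  (pushforward (jordan_pos (hahnP mu)) h) (pushforward (jordan_neg (hahnP mu)) h))//.
- have bfh := bmeasurable_comp h bf.
  have mf : measurable_fun setT (EFin \o f) by apply/measurable_EFinP; case: bf.
  rewrite /charge_integral /Rintegral.
  by congr (fine _ - fine _); apply: integral_pushforward => //; exact: jint bfh.
- exact: jfin.
- exact: jfin.
- move=> A mA; rewrite rpushE// jordan_decompE//.
  by rewrite -[X in measurable X]setTI; exact: mh.
Qed.

Lemma charge_integral_indic mu A : measurable A ->
  charge_integral mu (\1_A) = fine (mu A).
Proof.
move=> mA; rewrite /charge_integral /Rintegral !integral_indic// setIT.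
by rewrite jordan_decompE// fineB ?fin_num_measure.
Qed.

(** Dominated convergence with the constant [M] as dominating function, applied to each Jordan
    part. *)
Lemma charge_integral_cvg mu (f_ : (T -> R)^nat) f (M : R) :
  (forall n, measurable_fun setT (f_ n)) -> (forall n x, `|f_ n x| <= M) ->
  (forall x, f_ n x @[n --> \oo] --> f x) ->
  bmeasurable f /\
  charge_integral mu (f_ n) @[n --> \oo] --> charge_integral mu f.
Proof.
move=> mf_ f_M f_f.
have mf : measurable_fun setT f by apply: (measurable_fun_cvg mf_) => x _.
have bf : bmeasurable f.
  split=> //; exists M => x.
  apply: (@closed_cvg _ _ _ eventually_filter (fun n => f_ n x) (fun y => `|y| <= M)).
  - exact: closed_comp (fun y _ => @norm_continuous _ _ y) (@closed_le _ M).
  - by near=> n; exact: f_M.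
  - exact: f_f.
split => //.
suff H (m : {finite_measure set T -> \bar R}) :
    Rintegral m setT (f_ n) @[n --> \oo] --> Rintegral m setT f.
  by apply: cvgB; exact: H.
have ff x : (f_ n x)%:E @[n --> \oo] --> (f x)%:E.
  by apply/fine_cvgP; split; [exact: nearW|exact: f_f].
have [_ _] := @dominated_convergence _ _ _ m setT measurableT
  (fun n x => (f_ n x)%:E) (EFin \o f) (fun=> M%:E)
  (fun n => (measurable_EFinP _ _).2 (mf_ n)) ((measurable_EFinP _ _).2 mf)
  (aeW _ (fun x _ => ff x))
  (jint m (bmeasurable_cst _ M))
  (aeW _ (fun x n _ => f_M n x)).
move=> H; apply: fine_cvg.
rewrite fineK//; apply: integrable_fin_num => //; exact: jint.
Unshelve. all: by end_near. Qed.

End charge_integral.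

(** * A cubic whose iterates converge to the sign function *)

Section smoothstep.
Variable R : realType.
Implicit Types w : R.

(** An odd cubic with fixed points -1, 0 and 1, of which 0 is repelling and the other two attract.
    Being a polynomial, it maps an algebra of functions to itself. *)
Definition smoothstep w : R := (3 * w - w ^+ 3) / 2.

Lemma smoothstepN w : smoothstep (- w) = - smoothstep w.
Proof. by rewrite /smoothstep; field. Qed.

Lemma iter_smoothstepN n w : iter n smoothstep (- w) = - iter n smoothstep w.
Proof. by elim: n => //= n ->; exact: smoothstepN. Qed.

(** One step multiplies the gap to 1 by [(1 - v) * (2 + v) / 2 = 1 - v / 2 - v ^+ 2 / 2], which is
    at most [1 - w / 2] because the iterate [v] stays above [w]. *)
Lemma iter_smoothstep_bound n w : 0 < w <= 1 ->
  w <= iter n smoothstep w <= 1 /\ 1 - iter n smoothstep w <= (1 - w / 2) ^+ n.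
Proof.
move=> /andP[w0 w1]; elim: n => [|n [/andP[IH1 IH2] IH3]] /=.
  by rewrite lexx w1 expr0; split => //; lra.
set v := iter n smoothstep w in IH1 IH2 IH3 *.
have E : 1 - smoothstep v = (1 - v) * ((1 - v) * (2 + v) / 2).
  by rewrite /smoothstep; field.
have F : (1 - v) * (2 + v) / 2 <= 1 - w / 2 by nra.
have F0 : 0 <= (1 - v) * (2 + v) / 2 by nra.
split; last by rewrite E exprSr ler_pM//; lra.
by apply/andP; split; [rewrite /smoothstep; nra|nra].
Qed.

Lemma cvg_iter_smoothstep w : -1 <= w <= 1 ->
  iter n smoothstep w @[n --> \oo] --> Num.sg w.
Proof.
have pos v : 0 < v <= 1 -> iter n smoothstep v @[n --> \oo] --> (1 : R).
  move=> v01; have /andP[v0 v1] := v01.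
  have c0 : (1 - v / 2) ^+ n @[n --> \oo] --> (0 : R).
    by apply: cvg_expr; rewrite ger0_norm; lra.
  have c1 : 1 - (1 - v / 2) ^+ n @[n --> \oo] --> (1 - 0 : R).
    by apply: cvgB => //; exact: cvg_cst.
  rewrite subr0 in c1.
  apply: squeeze_cvgr c1 (@cvg_cst _ _ _ _ _); near=> n.
  have [/andP[_ h1] h2] := iter_smoothstep_bound n v01.
  by rewrite h1 andbT; lra.
move=> /andP[w1 w2]; case: (ltgtP w 0) => [w0|w0|->].
- rewrite ltr0_sg//.
  have -> : (fun n => iter n smoothstep w) = (fun n => - iter n smoothstep (- w)).
    by apply/funext => n; rewrite iter_smoothstepN opprK.
  by apply: cvgN; apply: pos; lra.
- by rewrite gtr0_sg//; apply: pos; lra.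
- rewrite sgr0 (_ : (fun n => _) = fun=> 0); first exact: cvg_cst.
  apply/funext; elim=> //= n ->; rewrite /smoothstep; ring.
Unshelve. all: by end_near. Qed.

Lemma iter_smoothstep_norm n w : -1 <= w <= 1 -> `|iter n smoothstep w| <= 1.
Proof.
move=> w1; elim: n => [|n IH] /=; first by rewrite ler_norml.
move: IH; rewrite !ler_norml; set v := iter _ _ _ => /andP[v1 v2].
(* The two products are twice [1 - smoothstep v] and twice [1 + smoothstep v]. *)
have h1 : 0 <= (1 - v) ^+ 2 * (2 + v) by apply: mulr_ge0; [exact: sqr_ge0|lra].
have h2 : 0 <= (1 + v) ^+ 2 * (2 - v) by apply: mulr_ge0; [exact: sqr_ge0|lra].
by rewrite /smoothstep; apply/andP; split; lra.
Qed.

End smoothstep.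

(** * Integer powers on the circle as cosines and sines *)

Section circle_trig.
Variable R : realType.
Local Notation T := (circle R).
Local Notation C := (R[i]).
Implicit Types (z : T) (nu : int).

Definition ccos nu z : R := cos (nu%:~R * argz z).
Definition csin nu z : R := sin (nu%:~R * argz z).

Lemma expiz (t : R) nu :
  cval (expi t) ^ nu = (cos (nu%:~R * t) +i* sin (nu%:~R * t))%C.
Proof.
have pos n : cval (expi t) ^+ n = (cos (n%:R * t) +i* sin (n%:R * t))%C.
  by have /(congr1 (@cval R)) := cpow_expi n t; rewrite cvalE.
case: nu => n; first exact: pos.
rewrite NegzE mulrNz mulNr cosN sinN -exprnN pos.
(* Multiplying a negative power by the opposite positive power reduces the claim to the Pythagorean
   identity. *)
apply: (@mulfI _ (cos (n.+1%:R * t) +i* sin (n.+1%:R * t))%C).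
  by rewrite -pos expf_neq0// -normr_eq0 cval_norm oner_neq0.
rewrite mulfV; last by rewrite -pos expf_neq0// -normr_eq0 cval_norm oner_neq0.
simpc; have := cos2Dsin2 (n.+1%:R * t).
set a := cos _; set b := sin _ => h.
by congr (_ +i* _)%C; [rewrite -[LHS]h|]; ring.
Qed.

Lemma cvalz z nu : cval z ^ nu = (ccos nu z +i* csin nu z)%C.
Proof. by rewrite -{1}(argzK z) expiz. Qed.

Lemma bmeasurable_ccos nu : bmeasurable (ccos nu).
Proof.
split; last by exists 1 => z; rewrite ler_norml cos_geN1 cos_le1.
have mcos : measurable_fun setT (@cos R).
  by apply: continuous_measurable_fun; exact: continuous_cos.
apply: (measurableT_comp mcos).
by apply: measurable_funM => //; exact: measurable_argz.
Qed.

Lemma bmeasurable_csin nu : bmeasurable (csin nu).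
Proof.
split; last by exists 1 => z; rewrite ler_norml sin_geN1 sin_le1.
have msin : measurable_fun setT (@sin R).
  by apply: continuous_measurable_fun; exact: continuous_sin.
apply: (measurableT_comp msin).
by apply: measurable_funM => //; exact: measurable_argz.
Qed.

Lemma fourier_coefE nu (mu : rmeasure T R) :
  fourier_coef nu mu =
  (charge_integral mu (ccos nu) +i* - charge_integral mu (csin nu))%C.
Proof.
rewrite /fourier_coef; congr (_ +i* _)%C.
  congr charge_integral; apply/funext => z.
  by rewrite cvalz /ccos /= mulrNz mulNr cosN.
rewrite -[RHS]mulN1r -charge_integralZr; last exact: bmeasurable_csin.
congr charge_integral; apply/funext => z.
by rewrite cvalz /csin /= mulrNz mulNr sinN mulN1r.
Qed.

End circle_trig.

(** * Uniqueness of Fourier coefficients *)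

Section fourier_uniqueness.
Variable R : realType.
Local Notation T := (circle R).
Variable mu : rmeasure T R.
Implicit Types (f g h w : T -> R) (nu : int) (B : set T).

(** This is the vanishing of all Fourier coefficients of the measure with density [g] relative to
    [mu], split into real and imaginary parts. *)
Definition fourier_null g := bmeasurable g /\ forall nu,
  charge_integral mu (fun z => g z * ccos nu z) = 0 /\
  charge_integral mu (fun z => g z * csin nu z) = 0.

Definition null_multiplier h :=
  bmeasurable h /\ forall g, fourier_null g -> fourier_null (fun z => h z * g z).

Lemma fourier_nullP g : bmeasurable g ->
  (forall nu, charge_integral mu (fun z => g z * ccos nu z) = 0) ->
  (forall nu, charge_integral mu (fun z => g z * csin nu z) = 0) ->
  fourier_null g.
Proof. by move=> bg cg sg; split. Qed.

Let bcos := @bmeasurable_ccos R.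
Let bsin := @bmeasurable_csin R.

Lemma fourier_null_lin a b f g : fourier_null f -> fourier_null g ->
  fourier_null (fun z => a * f z + b * g z).
Proof.
move=> [bf f0] [bg g0].
have key k : bmeasurable k -> charge_integral mu (fun z => f z * k z) = 0 ->
    charge_integral mu (fun z => g z * k z) = 0 ->
    charge_integral mu (fun z => (a * f z + b * g z) * k z) = 0.
  move=> bk fk gk; have bfk := bmeasurableM bf bk; have bgk := bmeasurableM bg bk.
  under eq_fun do rewrite mulrDl -!mulrA.
  by rewrite charge_integral_lin// fk gk !mulr0 addr0.
apply: fourier_nullP.
- by apply: bmeasurableD; exact: bmeasurableZ.
- by move=> nu; apply: key; [exact: bcos|apply: (f0 nu).1|apply: (g0 nu).1].
- by move=> nu; apply: key; [exact: bsin|apply: (f0 nu).2|apply: (g0 nu).2].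
Qed.

Lemma null_multiplier_cst a : null_multiplier (fun=> a).
Proof.
split=> [|g g0]; first exact: bmeasurable_cst.
have := @fourier_null_lin a 0 _ _ g0 g0.
by under eq_fun do rewrite mul0r addr0.
Qed.

Lemma null_multiplierD f h : null_multiplier f -> null_multiplier h ->
  null_multiplier (fun z => f z + h z).
Proof.
move=> [bf Af] [bh Ah]; split=> [|g g0]; first exact: bmeasurableD.
have := @fourier_null_lin 1 1 _ _ (Af g g0) (Ah g g0).
by under eq_fun do rewrite !mul1r -mulrDl.
Qed.

Lemma null_multiplierM f h : null_multiplier f -> null_multiplier h ->
  null_multiplier (fun z => f z * h z).
Proof.
move=> [bf Af] [bh Ah]; split=> [|g g0]; first exact: bmeasurableM.
by under eq_fun do rewrite -mulrA; exact/Af/Ah.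
Qed.

Lemma null_multiplierZ a h : null_multiplier h -> null_multiplier (fun z => a * h z).
Proof. exact/null_multiplierM/null_multiplier_cst. Qed.

Lemma null_multiplierN h : null_multiplier h -> null_multiplier (fun z => - h z).
Proof. by move=> /(null_multiplierZ (-1)); under eq_fun do rewrite mulN1r. Qed.

(** By the product-to-sum formulas, multiplying by the cosine averages the shifts of the frequency
    by 1 and -1, and all frequencies are covered by the hypothesis on [g]. *)
Lemma null_multiplier_cos : null_multiplier (ccos 1).
Proof.
split=> [//|g [bg g0]]; apply: fourier_nullP; first exact: bmeasurableM.
- move=> nu.
  have -> : (fun z => ccos 1 z * g z * ccos nu z) =
      fun z => 2^-1 * (g z * ccos (nu + 1) z) + 2^-1 * (g z * ccos (nu - 1) z).
    apply/funext => z; rewrite /ccos !intrD mulrNz !mulrDl !mulNr !mul1r !cosD cosN sinN.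
    by field.
  rewrite charge_integral_lin; [|exact: bmeasurableM..].
  by rewrite (g0 _).1 (g0 _).1 mulr0 addr0.
- move=> nu.
  have -> : (fun z => ccos 1 z * g z * csin nu z) =
      fun z => 2^-1 * (g z * csin (nu + 1) z) + 2^-1 * (g z * csin (nu - 1) z).
    apply/funext => z; rewrite /ccos /csin !intrD mulrNz !mulrDl !mulNr !mul1r !sinD cosN sinN.
    by field.
  rewrite charge_integral_lin; [|exact: bmeasurableM..].
  by rewrite (g0 _).2 (g0 _).2 mulr0 addr0.
Qed.

Lemma null_multiplier_sin : null_multiplier (csin 1).
Proof.
split=> [//|g [bg g0]]; apply: fourier_nullP; first exact: bmeasurableM.
- move=> nu.
  have -> : (fun z => csin 1 z * g z * ccos nu z) =
      fun z => 2^-1 * (g z * csin (nu + 1) z) + - 2^-1 * (g z * csin (nu - 1) z).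
    apply/funext => z; rewrite /ccos /csin !intrD mulrNz !mulrDl !mulNr !mul1r !sinD cosN sinN.
    by field.
  rewrite charge_integral_lin; [|exact: bmeasurableM..].
  by rewrite (g0 _).2 (g0 _).2 !mulr0 addr0.
- move=> nu.
  have -> : (fun z => csin 1 z * g z * csin nu z) =
      fun z => 2^-1 * (g z * ccos (nu - 1) z) + - 2^-1 * (g z * ccos (nu + 1) z).
    apply/funext => z; rewrite /ccos /csin !intrD mulrNz !mulrDl !mulNr !mul1r !cosD cosN sinN.
    by field.
  rewrite charge_integral_lin; [|exact: bmeasurableM..].
  by rewrite (g0 _).1 (g0 _).1 !mulr0 addr0.
Qed.

(** Bounded convergence, applied to the products of [h_ n] with [g] and a cosine or sine. *)
Lemma null_multiplier_cvg (h_ : (T -> R)^nat) h (M : R) :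
  (forall n, null_multiplier (h_ n)) -> (forall n z, `|h_ n z| <= M) ->
  (forall z, h_ n z @[n --> \oo] --> h z) -> null_multiplier h.
Proof.
move=> Ah_ h_M h_h; have mh n : measurable_fun setT (h_ n) by case: (Ah_ n) => -[].
have [bh _] := charge_integral_cvg mu mh h_M h_h.
split=> // g g0; have [bg _] := g0.
have lim0 k : bmeasurable k ->
    (forall n, charge_integral mu (fun z => h_ n z * g z * k z) = 0) ->
    charge_integral mu (fun z => h z * g z * k z) = 0.
  move=> bk h0; have [mgk [b gkb]] := bmeasurableM bg bk.
  have [||z|] := @charge_integral_cvg _ _ _ mu (fun n z => h_ n z * g z * k z)
    (fun z => h z * g z * k z) (M * b).
  - move=> n; under eq_fun do rewrite -mulrA.
    by apply: measurable_funM mgk.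
  - by move=> n z; rewrite -mulrA normrM ler_pM.
  - by apply: cvgMl; apply: cvgMl; exact: h_h.
  - move=> _; under eq_fun do rewrite h0.
    by move=> /cvg_lim <- //; rewrite lim_cst.
apply: fourier_nullP; first exact: bmeasurableM.
- by move=> nu; apply: lim0 => // n; have [_ /(_ g g0)[_ /(_ nu)[]]] := Ah_ n.
- by move=> nu; apply: lim0 => // n; have [_ /(_ g g0)[_ /(_ nu)[]]] := Ah_ n.
Qed.

Definition multiplier_set B := null_multiplier (\1_B).

Lemma multiplier_setT : multiplier_set setT.
Proof. by rewrite /multiplier_set indicT; exact: null_multiplier_cst. Qed.

Lemma multiplier_setC B : multiplier_set B -> multiplier_set (~` B).
Proof.
move=> /null_multiplierN/(null_multiplierD (null_multiplier_cst 1)); rewrite /multiplier_set.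
congr null_multiplier; apply/funext => z; rewrite !indicE in_setC.
by case: (z \in B); rewrite ?subrr ?subr0.
Qed.

Lemma multiplier_setI A B : multiplier_set A -> multiplier_set B -> multiplier_set (A `&` B).
Proof. by move=> nA nB; rewrite /multiplier_set indicI; exact: null_multiplierM. Qed.

Lemma multiplier_setU A B : multiplier_set A -> multiplier_set B -> multiplier_set (A `|` B).
Proof.
move=> nA nB; rewrite -[_ `|` _]setCK setCU.
by apply/multiplier_setC/multiplier_setI; exact: multiplier_setC.
Qed.

Lemma multiplier_set0 : multiplier_set set0.
Proof. by rewrite -setCT; apply/multiplier_setC/multiplier_setT. Qed.

(** At each point the indicators of the finite unions are eventually constant, so the union arises
    as a bounded pointwise limit. *)
Lemma multiplier_set_bigcup (F : (set T)^nat) :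
  (forall n, multiplier_set (F n)) -> multiplier_set (\bigcup_n F n).
Proof.
move=> nF; pose D n := \big[setU/set0]_(k < n) F k.
apply: (@null_multiplier_cvg (fun n => \1_(D n)) _ 1).
- rewrite /D; elim=> [|n IH]; first by rewrite big_ord0; exact: multiplier_set0.
  by rewrite big_ord_recr /=; exact: multiplier_setU.
- by move=> n z; rewrite indicE; case: (_ \in _); rewrite ?normr1 ?normr0.
- move=> z; have [[n _ Fnz]|nz] := pselect ((\bigcup_n F n) z).
    rewrite indicE mem_set; last by exists n.
    apply: cvg_near_cst; exists n.+1 => // m /= nm.
    by rewrite indicE mem_set// /D -bigcup_mkord; exists n.
  rewrite indicE memNset//; apply: cvg_near_cst; exists 0%N => // m _ /=.
  rewrite indicE memNset// /D -bigcup_mkord => -[k _ Fkz].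
  by apply: nz; exists k.
Qed.

(* [smoothstep] preserves [-1, 1] and its iterates converge to the sign
   everywhere on that interval. *)
Lemma multiplier_set_gt0 w : null_multiplier w -> multiplier_set [set z | 0 < w z].
Proof.
move=> Aw; have [[_ [M wM]] _] := Aw.
(* The added 1 keeps the divisor positive even when the bound [M] is 0. *)
have M0 : 0 < `|M| + 1 by rewrite ltr_wpDl.
pose v z := (`|M| + 1)^-1 * w z.
have v1 z : -1 <= v z <= 1.
  rewrite -ler_norml normrM gtr0_norm ?invr_gt0// ler_pdivrMl// mulr1.
  by rewrite (le_trans (wM z))// (le_trans (ler_norm M))// lerDl.
pose V n z := iter n (@smoothstep R) (v z).
have AV n : null_multiplier (V n).
  rewrite /V; elim: n => [|n IH]; first exact: null_multiplierZ.
  have -> : (fun z => iter n.+1 (@smoothstep R) (v z)) =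
      fun z => (3 / 2) * V n z + - ((2^-1 * V n z) * (V n z * V n z)).
    by apply/funext => z; rewrite /= -/(V n z) /smoothstep; field.
  apply: null_multiplierD; first exact: null_multiplierZ.
  apply: null_multiplierN; apply: null_multiplierM; first exact: null_multiplierZ.
  exact: null_multiplierM.
(* The polynomial [(x ^+ 2 + x) / 2] sends the signs 1, 0, -1 to 1, 0, 0, which turns the limiting
   sign into the indicator. *)
apply: (@null_multiplier_cvg (fun n z => 2^-1 * (V n z * V n z + V n z)) _ 1).
- by move=> n; apply/null_multiplierZ/null_multiplierD => //; exact: null_multiplierM.
- move=> n z; have := iter_smoothstep_norm n (v1 z); rewrite -/(V n z) !ler_norml.
  by move=> /andP[a b]; apply/andP; split; nra.
- move=> z; have Vz := cvg_iter_smoothstep (v1 z).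
  have -> : \1_[set z | 0 < w z] z = 2^-1 * (Num.sg (v z) * Num.sg (v z) + Num.sg (v z)).
    rewrite /v sgrM gtr0_sg ?invr_gt0// mul1r indicE.
    case: (ltgtP (w z) 0) => wz.
    - rewrite memNset /= ?ltr0_sg//; last by apply/negP; rewrite -leNgt ltW.
      by rewrite /=; ring.
    - by rewrite mem_set//= gtr0_sg//; field.
    - by rewrite memNset /= wz ?ltxx// sgr0; ring.
  by apply: cvgMr; apply: cvgD => //; exact: cvgM.
Qed.

Lemma cos_2piB (x : R) : cos (pi *+ 2 - x) = cos x.
Proof. by rewrite addrC cosD2pi cosN. Qed.

Lemma sin_argz_lt0 (z : T) : (sin (argz z) < 0) = (pi < argz z).
Proof.
have /andP[t0 t2] := argz_bound z; case: (ltP pi (argz z)) => tpi.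
  rewrite -(subrK pi (argz z)) sinDpi oppr_lt0.
  by apply: sin_gt0_pi; move: t2; rewrite mulr2n; lra.
by apply/negbTE; rewrite -leNgt sin_ge0_pi// t0.
Qed.

(** The sign of the sine tells on which side of [pi] the argument lies. On each side the cosine is
    monotone, decreasing up to [pi] and increasing after it by reflection, so comparing cosines
    compares arguments. *)
Lemma argz_gt_halfplanes (r : R) : 0 <= r < pi *+ 2 ->
  [set z : T | r < argz z] =
  if r <= pi then [set z | sin (argz z) < 0] `|`
    (~` [set z | sin (argz z) < 0] `&` [set z | cos (argz z) < cos r])
  else [set z | sin (argz z) < 0] `&` [set z | cos r < cos (argz z)].
Proof.
move=> /andP[r0 r2]; have pi0 := pi_gt0 R.
have ltc (x y : R) : 0 <= x <= pi -> 0 <= y <= pi -> (cos x < cos y) = (y < x).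
  by move=> x0 y0; rewrite ltr_cos// in_itv.
case: ifPn => rpi; apply/seteqP; split=> z /=; rewrite sin_argz_lt0;
  have /andP[t0 t2] := argz_bound z; move: r2 t2; rewrite mulr2n => r2 t2.
- case: (ltP pi (argz z)) => tpi rt; first by left.
  by right; split=> //; rewrite ltc// ?r0 ?t0.
- move=> [|[/negP]]; first lra.
  by rewrite -leNgt => tpi; rewrite ltc// ?r0 ?t0.
- move: rpi; rewrite -ltNge => rpi rt; split; first lra.
  by rewrite -(cos_2piB r) -(cos_2piB (argz z)) ltc ?mulr2n; lra.
- move: rpi; rewrite -ltNge => rpi [tpi].
  by rewrite -(cos_2piB r) -(cos_2piB (argz z)) ltc ?mulr2n; lra.
Qed.

Lemma multiplier_set_lt c f : null_multiplier f -> multiplier_set [set z | f z < c].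
Proof.
move=> Af; have -> : [set z | f z < c] = [set z | 0 < c + - f z].
  by apply/funext => z; rewrite /= subr_gt0.
apply: (@multiplier_set_gt0 (fun z => c + - f z)).
apply: null_multiplierD; first exact: null_multiplier_cst.
exact: null_multiplierN.
Qed.

Lemma multiplier_set_gt c f : null_multiplier f -> multiplier_set [set z | c < f z].
Proof.
move=> Af; have -> : [set z | c < f z] = [set z | 0 < f z + - c].
  by apply/funext => z; rewrite /= subr_gt0.
apply: (@multiplier_set_gt0 (fun z => f z + - c)).
by apply: null_multiplierD => //; exact: null_multiplier_cst.
Qed.

Lemma multiplier_set_argz_gt (r : R) : multiplier_set [set z : T | r < argz z].
Proof.
have Ac : null_multiplier (fun z => cos (argz z)).
  by have := null_multiplier_cos; congr null_multiplier; apply/funext => z;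
    rewrite /ccos mul1r.
have As : null_multiplier (fun z => sin (argz z)).
  by have := null_multiplier_sin; congr null_multiplier; apply/funext => z;
    rewrite /csin mul1r.
have [r0|r0] := ltP r 0.
  rewrite (_ : [set _ | _] = setT); first exact: multiplier_setT.
  apply/seteqP; split=> z //= _; have /andP[t0 _] := argz_bound z.
  exact: lt_le_trans r0 t0.
have [r2|r2] := ltP r (pi *+ 2); last first.
  rewrite (_ : [set _ | _] = set0); first exact: multiplier_set0.
  apply/seteqP; split=> z //= rz; have /andP[_] := argz_bound z.
  by move=> /lt_le_trans/(_ r2)/lt_trans/(_ rz); rewrite ltxx.
rewrite argz_gt_halfplanes ?r0//; case: ifPn => _.
  apply: multiplier_setU; first exact: multiplier_set_lt.
  by apply: multiplier_setI; [apply: multiplier_setC|]; exact: multiplier_set_lt.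
by apply: multiplier_setI; [exact: multiplier_set_lt|exact: multiplier_set_gt].
Qed.

(** Each Borel set of the circle is the preimage under [argz] of a Borel set of the line, and the
    rays []r, +oo[] generate the latter. *)
Lemma multiplier_set_measurable (E : set T) : measurable E -> multiplier_set E.
Proof.
move=> mE; have -> : E = @argz R @^-1` (@expi R @^-1` E).
  by apply/funext => z; rewrite /= argzK.
have mB : measurable (@expi R @^-1` E).
  by rewrite -[X in measurable X]setTI; exact: measurable_expi.
move: (_ @^-1` E) mB => B mB.
have {mB} : <<s @RGenOInfty.G R >> B.
  by have := mB; rewrite [X in X B](@RGenOInfty.measurableE R).
move: B; apply: (@smallest_sub _ (sigma_algebra setT) _
  [set B | multiplier_set (@argz R @^-1` B)]).
  split.
  - by rewrite /= preimage_set0; exact: multiplier_set0.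
  - by move=> B nB /=; rewrite setTD preimage_setC; exact: multiplier_setC.
  - by move=> F nF /=; rewrite preimage_bigcup; exact: multiplier_set_bigcup.
move=> _ [r ->] /=; rewrite (_ : _ @^-1` _ = [set z | r < argz z]).
  exact: multiplier_set_argz_gt.
by apply/seteqP; split=> z /=; rewrite in_itv /= andbT.
Qed.

(** The hypothesis says that the constant 1 is [fourier_null]. Multiplying it by the indicator of
    [A] and reading off frequency 0 yields the mass of [A]. *)
Lemma fourier_coef_eq0 : (forall nu, fourier_coef nu mu = 0) -> mu = 0.
Proof.
move=> mu0; apply: rmeasureP => A mA; rewrite rmeasure0.
have one0 : fourier_null (fun=> 1).
  split; first exact: bmeasurable_cst.
  have E (k : T -> R) : (fun z => 1 * k z) = k by apply/funext => z; rewrite mul1r.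
  move=> nu; rewrite !E.
  have := mu0 nu; rewrite fourier_coefE => /eqP; rewrite eq_complex /= oppr_eq0.
  by move=> /andP[/eqP-> /eqP->].
have [_ /(_ _ one0)[_ /(_ 0)[+ _]]] := multiplier_set_measurable mA.
under eq_fun do rewrite /ccos mul0r cos0 !mulr1.
rewrite charge_integral_indic// => h; rewrite -(fineK (fin_num_measure mu A mA)).
by rewrite h.
Qed.

End fourier_uniqueness.

(** * Roots of unity and branches of the n-th root *)

Section roots_of_unity.
Variable R : realType.
Local Notation T := (circle R).
Local Notation C := (R[i]).
Implicit Types (z w : T) (nu : int) (n : nat).

Lemma expiD (s t : R) : expi (s + t) = crot (expi s) (expi t).
Proof.
by apply: circle_eq; rewrite /= ?cosD ?sinD//; ring.
Qed.

Definition unity_root n (k : nat) : T := expi (2 * pi * k%:R / n%:R).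

Lemma branchE n k z : branch n k z = crot (unity_root n k) (branch n 0 z).
Proof.
rewrite /branch -expiD; congr expi.
by rewrite mulr0 addr0 addrC mulrDl.
Qed.

Lemma cpow_branch n k z : (0 < n)%N -> cpow n (branch n k z) = z.
Proof.
move=> n0; rewrite cpow_expi mulrC divfK ?pnatr_eq0 -?lt0n//.
have -> : 2 * pi * k%:R = (pi *+ 2) *+ k :> R by rewrite -mulr_natr -(mulr_natr pi); ring.
by rewrite expiDn argzK.
Qed.

Lemma unity_root_lt n k : (k < n)%N -> argz (unity_root n k) = 2 * pi * k%:R / n%:R.
Proof.
move=> kn; have n0 : 0 < n%:R :> R by rewrite ltr0n (leq_ltn_trans _ kn).
have pi0 := pi_gt0 R; rewrite expiK//; apply/andP; split.
  by rewrite divr_ge0// ?(ltW n0)// !mulr_ge0// ltW.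
by rewrite ltr_pdivrMr// -[pi *+ 2]mulr_natl ltr_pM2l ?mulr_gt0// ltr_nat.
Qed.

Lemma cval_unity_root n k nu :
  cval (unity_root n k) ^ nu = (cval (unity_root n 1) ^ nu) ^+ k.
Proof.
rewrite exprnP exprz_exp !expiz intrM -pmulrn mulr1.
have -> : nu%:~R * (2 * pi * k%:R / n%:R) = nu%:~R * k%:R * (2 * pi / n%:R) :> R by ring.
by [].
Qed.

Lemma cval_neq0 z : cval z != 0.
Proof. by rewrite -normr_eq0 cval_norm oner_neq0. Qed.

Lemma cval_unity_rootX n : (0 < n)%N -> cval (unity_root n 1) ^+ n = 1.
Proof.
move=> n0; have := congr1 (@cval R) (cpow_expi n (2 * pi * 1 / n%:R)); rewrite cvalE => ->.
rewrite mulrC divfK ?pnatr_eq0 -?lt0n// mulr1 mulr_natl.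
by have := congr1 (@cval R) (expiDn 0 1); rewrite mulr1n add0r => ->; rewrite cvalE cos0 sin0.
Qed.

Lemma unity_root_inj n k l : (k < n)%N -> (l < n)%N ->
  unity_root n k = unity_root n l -> k = l.
Proof.
move=> kn ln /(congr1 (@argz R)); rewrite !unity_root_lt//.
have n0 : n%:R != 0 :> R by rewrite pnatr_eq0 -lt0n (leq_ltn_trans _ kn).
move=> /(mulIf (invr_neq0 n0))/mulfI => /(_ _)/eqP.
by rewrite eqr_nat => /(_ _)/eqP; apply; rewrite mulf_neq0// gt_eqF// pi_gt0.
Qed.

(** Only the residue of [nu] modulo [n] matters, and roots with different indices below [n] have
    different arguments. *)
Lemma unity_root_eq1 n nu : (0 < n)%N ->
  (cval (unity_root n 1) ^ nu == 1) = (n %| nu)%Z.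
Proof.
move=> n0; set w := cval _; have wn : w ^ n%:Z = 1 by exact: cval_unity_rootX.
have wM q : w ^ (q * n%:Z) = 1 by rewrite mulrC -exprz_exp wn exp1rz.
have nZ0 : n%:Z != 0 by rewrite eqz_nat -lt0n.
apply/eqP/idP => [|/dvdzP[q ->]//].
rewrite {1}(divz_eq nu n) expfzDr ?cval_neq0// wM mul1r => h; apply/dvdz_mod0P.
have := ltz_pmod nu (n0 : 0 < n%:Z); have := modz_ge0 nu nZ0; move: h.
case: (nu %% n)%Z => // r wr _ rn.
have : unity_root n r = unity_root n 0.
  apply: cval_inj; have := cval_unity_root n r 1; rewrite expr1z => ->.
  rewrite expr1z -[_ ^+ r]/(w ^ r%:Z) wr.
  by have := cval_unity_root n 0 1; rewrite expr1z expr0 => ->.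
by move=> /unity_root_inj ->.
Qed.

(** Up to the factor [cval z ^ nu] the sum is geometric, with a ratio whose [n]-th power is 1. It
    vanishes unless the ratio is 1, that is, unless [n] divides [nu]. *)
Lemma sum_unity_roots n nu z : (0 < n)%N ->
  \sum_(k < n) cval (crot (unity_root n k) z) ^ nu =
  if (n %| nu)%Z then n%:R * cval z ^ nu else 0.
Proof.
move=> n0; under eq_bigr do rewrite cvalE expfzMl cval_unity_root.
rewrite -mulr_suml; case: ifPn => nnu.
  have /eqP -> : cval (unity_root n 1) ^ nu == 1 by rewrite unity_root_eq1.
  by under eq_bigr do rewrite expr1n; rewrite sumr_const card_ord.
set w := _ ^ nu; have w1 : w != 1 by rewrite unity_root_eq1.
suff -> : \sum_(i < n) w ^+ i = 0 by rewrite mul0r.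
apply: (mulfI (_ : w - 1 != 0)); first by rewrite subr_eq0.
rewrite -subrX1 mulr0 /w exprnP exprz_exp mulrC -exprz_exp -exprnP.
by rewrite cval_unity_rootX// exp1rz subrr.
Qed.

Lemma sum_unity_roots_trig n nu z : (0 < n)%N ->
  \sum_(k < n) ccos nu (crot (unity_root n k) z) =
    (if (n %| nu)%Z then n%:R * ccos nu z else 0) /\
  \sum_(k < n) csin nu (crot (unity_root n k) z) =
    (if (n %| nu)%Z then n%:R * csin nu z else 0).
Proof.
move=> n0; have := sum_unity_roots nu z n0; under eq_bigr do rewrite cvalz.
rewrite cvalz.
have -> : \sum_(k < n) (ccos nu (crot (unity_root n k) z) +i*
    csin nu (crot (unity_root n k) z))%C =
  ((\sum_(k < n) ccos nu (crot (unity_root n k) z)) +i*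
   (\sum_(k < n) csin nu (crot (unity_root n k) z)))%C.
  by elim/big_rec3 : _ => [//|k a b c _ ->]; simpc.
have -> : n%:R = (n%:R)%:C%C :> C by rewrite rmorph_nat.
by case: ifP => _; simpc; case.
Qed.

Lemma ccos_cpow n nu z : ccos nu (cpow n z) = ccos (n%:Z * nu) z /\
  csin nu (cpow n z) = csin (n%:Z * nu) z.
Proof.
have := cvalz (cpow n z) nu; rewrite cvalE exprnP exprz_exp cvalz.
by case.
Qed.

End roots_of_unity.

(** * Fourier coefficients of the operators and of Haar measure *)

Section fourier_operators.
Variable R : realType.
Local Notation T := (circle R).
Local Notation C := (R[i]).
Local Notation M := (rmeasure T R).
Implicit Types (mu : M) (nu : int) (n : nat).

Lemma fourier_coef_is_zmod nu : zmod_morphism (@fourier_coef R nu).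
Proof.
move=> mu1 mu2; rewrite !fourier_coefE.
rewrite !charge_integralB; [|exact: bmeasurable_csin|exact: bmeasurable_ccos].
by simpc; congr (_ +i* _)%C; ring.
Qed.
HB.instance Definition _ nu :=
  GRing.isZmodMorphism.Build M C (@fourier_coef R nu) (fourier_coef_is_zmod nu).

Lemma fourier_coef_inj mu1 mu2 :
  (forall nu, fourier_coef nu mu1 = fourier_coef nu mu2) -> mu1 = mu2.
Proof.
move=> h; apply/eqP; rewrite -subr_eq0; apply/eqP/fourier_coef_eq0 => nu.
by rewrite raddfB /= h subrr.
Qed.

Lemma fourier_coef0 mu : fourier_coef 0 mu = (fine (mu setT))%:C%C.
Proof.
rewrite fourier_coefE.
have -> : ccos 0 = (fun=> 1) :> (T -> R) by apply/funext => z; rewrite /ccos mul0r cos0.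
have -> : csin 0 = (fun=> 0) :> (T -> R) by apply/funext => z; rewrite /csin mul0r sin0.
by rewrite !charge_integral_cst mul1r mul0r oppr0.
Qed.

Lemma fourier_coef_push n nu mu :
  fourier_coef nu (push n mu) = fourier_coef (n%:Z * nu) mu.
Proof.
rewrite !fourier_coefE.
rewrite !charge_integral_push; [|exact: bmeasurable_csin|exact: bmeasurable_ccos].
congr (_ +i* - _)%C; congr charge_integral; apply/funext => z.
- by have [-> _] := ccos_cpow n nu z.
- by have [_ ->] := ccos_cpow n nu z.
Qed.

Lemma rmeasure_sum n (F : 'I_n -> M) A : measurable A ->
  (\sum_(k < n) F k)%R A = (\sum_(k < n) F k A)%E.
Proof.
move=> mA; elim: n F => [|n IH] F; first by rewrite !big_ord0 rmeasure0.
by rewrite !big_ord_recr /= rmeasureD// IH.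
Qed.

Lemma pullbackE n mu :
  pullback n mu = n%:R^-1 *: \sum_(k < n) rpush (branch n k) mu.
Proof.
apply: rmeasureP => A mA; rewrite rmeasure_ofE// rmeasureZ// rmeasure_sum// /pullback_fun.
congr (_ * _)%E; apply: eq_bigr => k _; rewrite rpushE// cpow_sector//.
exact: leq_ltn_trans (ltn_ord k).
Qed.

(** The index is the integer part of [n * argz z / (2 * pi)], the number of the sector containing
    [z]. *)
Lemma branch_cpow n (z : T) : (0 < n)%N ->
  exists2 k, (k < n)%N & z = branch n k (cpow n z).
Proof.
move=> n0; have /andP[t0 t2] := argz_bound z; have p0 := pi2_gt0 R.
have n0R : 0 < n%:R :> R by rewrite ltr0n.
set x := n%:R * argz z / (pi *+ 2).
have x0 : 0 <= x by rewrite divr_ge0 ?mulr_ge0// ltW.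
have /andP[k1 k2] := truncn_itv x0; set k := Num.truncn x in k1 k2.
have xn : x < n%:R by rewrite ltr_pdivrMr// ltr_pM2l.
exists k; first by rewrite -(ltr_nat R) (le_lt_trans k1).
rewrite -{2}(argzK z) cpow_expi.
have -> : n%:R * argz z = (n%:R * argz z - (pi *+ 2) *+ k) + (pi *+ 2) *+ k by rewrite subrK.
rewrite expiDn /branch expiK; last first.
  rewrite ler_pdivlMr// in k1; rewrite ltr_pdivrMr// -natr1 mulrDl mul1r in k2.
  by rewrite -mulr_natl; apply/andP; split; lra.
rewrite -{1}(argzK z); congr expi.
have -> : 2 * pi * k%:R = (pi *+ 2) *+ k :> R by rewrite -mulr_natr -(mulr_natr pi); ring.
by rewrite subrK mulrC mulKf// gt_eqF.
Qed.

(** The indices below [n] parametrize the [n]-th roots of unity bijectively. Each root is hit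
    because it is the value at 1 of some branch. *)
Lemma averageE n mu : (0 < n)%N ->
  average n mu = n%:R^-1 *: \sum_(k < n) rpush (crot (unity_root R n k)) mu.
Proof.
move=> n0; rewrite /average; congr (_ *: _).
rewrite (fsbig_ord _ _ (fun k => rpush (crot (unity_root R n k)) mu)).
apply: (@reindex_fsbig _ _ _ _ _ (unity_root R n)); split.
- move=> k /= kn; apply: (_ : cval (unity_root R n k) ^ n%:Z = 1).
  by rewrite cval_unity_root -exprnP cval_unity_rootX// expr1n.
- by move=> k l; rewrite !inE /= => kn ln; exact: unity_root_inj.
- move=> z /= zn; have [k kn ->] := branch_cpow z n0; exists k => //.
  have -> : cpow n z = expi 0 by apply: cval_inj; rewrite !cvalE cos0 sin0.
  by rewrite /branch expiK ?add0r// lexx pi2_gt0.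
Qed.

Lemma charge_integral_sumr mu n (F : 'I_n -> T -> R) : (forall k, bmeasurable (F k)) ->
  charge_integral mu (fun z => \sum_(k < n) F k z) =
  \sum_(k < n) charge_integral mu (F k).
Proof.
(* Boundedness of the partial sums is carried through the induction, since additivity of the
   integral needs it. *)
move=> bF; suff [] : bmeasurable (fun z => \sum_(k < n) F k z) /\
   charge_integral mu (fun z => \sum_(k < n) F k z) =
  \sum_(k < n) charge_integral mu (F k) by [].
elim: n F bF => [|n IH] F bF.
  under eq_fun do rewrite big_ord0; rewrite big_ord0 charge_integral_cst mul0r.
  by split=> //; exact: bmeasurable_cst.
under eq_fun do rewrite big_ord_recr /=; rewrite big_ord_recr /=.
have [b1 h1] := IH (fun k => F (widen_ord (leqnSn n) k)) (fun k => bF _).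
by split; [exact: bmeasurableD|rewrite charge_integralDr// h1].
Qed.

Lemma charge_integral_average n mu (h : nat -> {mfun T >-> T}) (f : T -> R) :
  bmeasurable f ->
  charge_integral (n%:R^-1 *: \sum_(k < n) rpush (h k) mu) f =
  n%:R^-1 * charge_integral mu (fun z => \sum_(k < n) f (h k z)).
Proof.
move=> bf; rewrite charge_integralV// charge_integral_sum// charge_integral_sumr.
  by congr (_ * _); apply: eq_bigr => k _; rewrite charge_integral_push.
by move=> k; exact: bmeasurable_comp.
Qed.

(** The branch values at [z] are the rotations of [branch n 0 z] by the [n]-th roots of unity.
    Summing over them kills the frequencies not divisible by [n]; for the others,
    [cpow n (branch n 0 z) = z] divides the frequency by [n]. *)
Lemma fourier_coef_pullback n nu mu : (0 < n)%N ->
  fourier_coef nu (pullback n mu) =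
  if (n %| nu)%Z then fourier_coef (nu %/ n)%Z mu else 0.
Proof.
move=> n0; rewrite !fourier_coefE pullbackE.
rewrite !charge_integral_average; [|exact: bmeasurable_csin|exact: bmeasurable_ccos].
have n0R : n%:R != 0 :> R by rewrite pnatr_eq0 -lt0n.
have [E1 E2] : (fun z : T => \sum_(k < n) ccos nu (branch n k z)) =
    (fun z => if (n %| nu)%Z then n%:R * ccos (nu %/ n)%Z z else 0) /\
    (fun z : T => \sum_(k < n) csin nu (branch n k z)) =
    (fun z => if (n %| nu)%Z then n%:R * csin (nu %/ n)%Z z else 0).
  split; apply/funext => z; under eq_bigr do rewrite branchE.
    rewrite (sum_unity_roots_trig nu (branch n 0 z) n0).1; case: ifP => // nnu.
    have [E _] := ccos_cpow n (nu %/ n)%Z (branch n 0 z).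
    by rewrite cpow_branch// mulrC divzK// in E; rewrite E.
  rewrite (sum_unity_roots_trig nu (branch n 0 z) n0).2; case: ifP => // nnu.
  have [_ E] := ccos_cpow n (nu %/ n)%Z (branch n 0 z).
  by rewrite cpow_branch// mulrC divzK// in E; rewrite E.
rewrite E1 E2; case: ifP => _; last by rewrite charge_integral_cst mul0r mulr0 oppr0.
rewrite !charge_integralZr; [|exact: bmeasurable_csin|exact: bmeasurable_ccos].
by rewrite !mulKf.
Qed.

Lemma fourier_coef_average n nu mu : (0 < n)%N ->
  fourier_coef nu (average n mu) = if (n %| nu)%Z then fourier_coef nu mu else 0.
Proof.
move=> n0; rewrite !fourier_coefE averageE//.
have avg := charge_integral_average n mu
  (fun k => [the {mfun T >-> T} of crot (unity_root R n k)] : {mfun T >-> T}).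
rewrite !avg; [|exact: bmeasurable_csin|exact: bmeasurable_ccos].
have n0R : n%:R != 0 :> R by rewrite pnatr_eq0 -lt0n.
under eq_fun do rewrite (sum_unity_roots_trig _ _ n0).1.
under [in X in (_ +i* X)%C]eq_fun do rewrite (sum_unity_roots_trig _ _ n0).2.
case: ifP => _; last by rewrite charge_integral_cst mul0r mulr0 oppr0.
rewrite !charge_integralZr; [|exact: bmeasurable_csin|exact: bmeasurable_ccos].
by rewrite !mulKf.
Qed.

Lemma haarME A : measurable A -> haarM R A = haar R A.
Proof. by move=> mA; rewrite rmeasure_ofE. Qed.

Lemma uniform_prob_lty : (uniform_prob (pi2_gt0 R) setT < +oo)%E.
Proof. by rewrite probability_setT ltry. Qed.

Lemma haar_lty : (haar R setT < +oo)%E.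
Proof. by rewrite probability_setT ltry. Qed.

(** The mean of [f + 1] is computed instead of that of [f], because [integral_uniform] asks for a
    nonnegative integrand. Its antiderivative [F t + t] grows by exactly the length of the interval,
    so the mean is 1. *)
Lemma uniform_integral_periodic (f F : R -> R) :
  (forall t, -1 <= f t <= 1) -> continuous f ->
  (forall t : R, is_derive t (1 : R) F (f t)) -> F 0 = F (pi *+ 2) ->
  (\int[uniform_prob (pi2_gt0 R)]_t f t)%R = 0.
Proof.
move=> f1 cf dF F0.
have mf : measurable_fun setT f by exact: continuous_measurable_fun.
have bf : bmeasurable (f : measurableTypeR R -> R).
  by split=> //; exists 1 => t; rewrite ler_norml.
have dG (t : R) : is_derive t (1 : R) (fun t => F t + t) (f t + 1).
  by apply: is_deriveD.
have cG t : {for t, continuous (fun t => F t + t)}.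
  by apply: differentiable_continuous; apply/derivable1_diffP; have [] := dG t.
have U1 : (\int[uniform_prob (pi2_gt0 R)]_t (f t + 1))%R = 1.
  rewrite /Rintegral integral_uniform; last 2 first.
  - by apply/measurable_EFinP; apply: measurable_funD.
  - by move=> t; rewrite lee_fin; have /andP[] := f1 t; lra.
  rewrite (@continuous_FTC2 _ _ (fun t => F t + t)) ?pi2_gt0//.
  - rewrite -EFinB -EFinM /= F0 subr0 addr0 [X in _ * X]addrAC subrr add0r mulVf//.
    by rewrite gt_eqF// pi2_gt0.
  - apply: continuous_subspaceT => t; apply: cvgD; [exact: cf|exact: cvg_cst].
  - split.
    + by move=> t _; have [] := dG t.
    + by apply: cvg_at_right_filter; exact: cG.
    + by apply: cvg_at_left_filter; exact: cG.
  - by move=> t _; rewrite derive1E; have [_] := dG t.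
have iU g : bmeasurable g -> (uniform_prob (pi2_gt0 R)).-integrable setT (EFin \o g).
  by apply: bmeasurable_integrable; exact: uniform_prob_lty.
move: U1; rewrite RintegralD ?Rintegral_cst//; [|exact: iU|exact/iU/bmeasurable_cst].
move=> U1.
have : fine (uniform_prob (pi2_gt0 R) setT) = 1 by rewrite probability_setT.
by move=> e; move: U1; rewrite e; lra.
Qed.

Lemma is_derive_scale (a : R) (f : R -> R) (t b : R) :
  is_derive (a * t) (1 : R) f b -> is_derive t (1 : R) (fun t => f (a * t)) (a * b).
Proof.
move=> df; have dg : is_derive t (1 : R) ( *%R a) a.
  have := @is_deriveZ _ _ _ id a t (1 : R) 1 (is_derive_id t 1).
  by rewrite /GRing.scale /= mulr1.
have := @is_derive1_comp _ f ( *%R a) t b a df dg.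
by rewrite mulrC.
Qed.

Lemma fourier_coef_haar nu : nu != 0 -> fourier_coef nu (haarM R) = 0.
Proof.
move=> nu0; rewrite fourier_coefE.
have key f : bmeasurable f -> charge_integral (haarM R) f =
    (\int[uniform_prob (pi2_gt0 R)]_t f (expi t))%R.
  (* Subtracting the zero measure exhibits Haar measure as a difference, which replaces its Jordan
     parts by [haar] itself. *)
  move=> bf; rewrite (@charge_integral_diff _ _ _ _ (haar R) mzero)//.
  - have [mf [a fa]] := bf.
    have z0 : (\int[@mzero _ T R]_x f x)%R = 0 by rewrite /Rintegral integral_measure_zero.
    rewrite z0 subr0; congr fine.
    apply: (@integral_pushforward _ _ _ _ _ (@expiT R)) => //.
      by apply/measurable_EFinP.
    apply: (bmeasurable_integrable (f := fun t => f (expiT t))).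
      exact: uniform_prob_lty.
    split; last by exists a.
    by apply: measurableT_comp mf _.
  - exact: haar_lty.
  - exact: (ltry 0).
  - by move=> A mA; rewrite haarME// sube0.
have a0 : nu%:~R != 0 :> R by rewrite intr_eq0.
have [E1 E2] : (fun t => ccos nu (expi t)) = (fun t : R => cos (nu%:~R * t)) /\
    (fun t => csin nu (expi t)) = (fun t : R => sin (nu%:~R * t)).
  by split; apply/funext => t; have := cvalz (expi t) nu; rewrite expiz => -[].
have ca : continuous ( *%R (nu%:~R : R)) by exact: mulrl_continuous.
rewrite !key ?E1 ?E2; [|exact: bmeasurable_csin|exact: bmeasurable_ccos].
have per : cos (nu%:~R * 0) = cos (nu%:~R * (pi *+ 2)) :> R /\
    sin (nu%:~R * 0) = sin (nu%:~R * (pi *+ 2)) :> R.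
  have := congr1 (fun z => cval z ^ nu) (expiDn (0 : R) 1).
  by rewrite /= !expiz mulr1n add0r => -[-> ->].
have I1 : (\int[uniform_prob (pi2_gt0 R)]_t cos (nu%:~R * t))%R = 0.
  apply: (@uniform_integral_periodic _ (fun t => nu%:~R^-1 * sin (nu%:~R * t))).
  - by move=> t; rewrite cos_geN1 cos_le1.
  - by move=> t; apply: continuous_comp; [exact: ca|exact: continuous_cos].
  - move=> t; have := @is_derive_scale nu%:~R (fun u => nu%:~R^-1 * sin u) t _
      (is_deriveZ (nu%:~R^-1) (is_derive_sin (nu%:~R * t))).
    by rewrite /GRing.scale /= mulVKf.
  - by rewrite per.2.
have I2 : (\int[uniform_prob (pi2_gt0 R)]_t sin (nu%:~R * t))%R = 0.
  apply: (@uniform_integral_periodic _ (fun t => - nu%:~R^-1 * cos (nu%:~R * t))).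
  - by move=> t; rewrite sin_geN1 sin_le1.
  - by move=> t; apply: continuous_comp; [exact: ca|exact: continuous_sin].
  - move=> t; have := @is_derive_scale nu%:~R (fun u => - nu%:~R^-1 * cos u) t _
      (is_deriveZ (- nu%:~R^-1) (is_derive_cos (nu%:~R * t))).
    by rewrite /GRing.scale /= mulrN mulNr opprK mulVKf.
  - by rewrite per.1.
by rewrite I1 I2 oppr0.
Qed.

End fourier_operators.

(** * Operator identities, singular measures and atoms *)

Section operator_identities.
Variable R : realType.
Local Notation T := (circle R).
Local Notation C := (R[i]).
Local Notation M := (rmeasure T R).
Implicit Types (mu : M) (nu : int) (n m : nat).

Lemma push_pullback n mu : (0 < n)%N -> push n (pullback n mu) = mu.
Proof.
move=> n0; apply: fourier_coef_inj => nu.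
rewrite fourier_coef_push fourier_coef_pullback// dvdz_mulr//.
by rewrite mulKz// eqz_nat -lt0n.
Qed.

Lemma pullback_push n mu : (0 < n)%N -> pullback n (push n mu) = average n mu.
Proof.
move=> n0; apply: fourier_coef_inj => nu.
rewrite fourier_coef_pullback// fourier_coef_average//; case: ifP => // nnu.
by rewrite fourier_coef_push mulrC divzK.
Qed.

Lemma push_pullbackC m n mu : (0 < n)%N -> coprime m n ->
  push m (pullback n mu) = pullback n (push m mu).
Proof.
move=> n0 mn; apply: fourier_coef_inj => nu.
rewrite fourier_coef_push !fourier_coef_pullback// fourier_coef_push.
(* By coprimality [n] divides [m * nu] exactly when it divides [nu]. *)
rewrite Gauss_dvdzr ?coprimezE 1?coprime_sym//; case: ifP => // /dvdzP[q ->].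
by rewrite mulrA !mulzK// eqz_nat -lt0n.
Qed.

Lemma push_push m n mu : push m (push n mu) = push (m * n)%N mu.
Proof.
by apply: fourier_coef_inj => nu; rewrite !fourier_coef_push PoszM mulrCA mulrA.
Qed.

Lemma pullback_is_zmod n : (0 < n)%N -> zmod_morphism (@pullback R n).
Proof.
move=> n0 mu1 mu2; apply: fourier_coef_inj => nu.
rewrite raddfB /= !fourier_coef_pullback//; case: ifP => _; last by rewrite subrr.
by rewrite raddfB.
Qed.

Lemma rpushZ (f : {mfun T >-> T}) a mu : rpush f (a *: mu) = a *: rpush f mu.
Proof.
apply: rmeasureP => A mA; have mf : measurable (f @^-1` A) by exact: measurable_funPTI.
by rewrite rmeasureZ// !rpushE// rmeasureZ.
Qed.

Lemma pullbackZ n a mu : pullback n (a *: mu) = a *: pullback n mu.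
Proof.
rewrite !pullbackE scalerA mulrC -scalerA; congr (_ *: _).
by rewrite scaler_sumr; apply: eq_bigr => k _; rewrite rpushZ.
Qed.

Lemma push_setT n mu : push n mu setT = mu setT.
Proof. by rewrite rpushE// preimage_setT. Qed.

(** The total mass is the Fourier coefficient of index 0. *)
Lemma pullback_setT n mu : (0 < n)%N -> pullback n mu setT = mu setT.
Proof.
move=> n0; have := fourier_coef_pullback 0 mu n0; rewrite dvdz0 div0z !fourier_coef0.
move=> [h]; rewrite -(fineK (fin_num_measure (pullback n mu) setT measurableT)) h.
by rewrite fineK// fin_num_measure.
Qed.

Lemma push_haar n : (0 < n)%N -> push n (haarM R) = haarM R.
Proof.
move=> n0; apply: fourier_coef_inj => nu; rewrite fourier_coef_push.
have [->|nu0] := eqVneq nu 0; first by rewrite mulr0.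
by rewrite !fourier_coef_haar// mulf_neq0// eqz_nat -lt0n.
Qed.

Lemma pullback_haar n : (0 < n)%N -> pullback n (haarM R) = haarM R.
Proof.
move=> n0; apply: fourier_coef_inj => nu; rewrite fourier_coef_pullback//.
case: ifPn => [/dvdzP[q ->]|nnu].
  have nZ : n%:Z != 0 by rewrite eqz_nat -lt0n.
  rewrite mulzK//; have [->|q0] := eqVneq q 0; first by rewrite mul0r.
  by rewrite !fourier_coef_haar// mulf_neq0.
by rewrite fourier_coef_haar//; apply: contraNneq nnu => ->; exact: dvdz0.
Qed.

(** The preimage of the null carrier [A] under [cpow n] carries the pull-back, and it is null
    because push-forward fixes Haar measure. *)
Lemma singular_pullback n mu : (0 < n)%N ->
  mutually_singular mu (haar R) -> mutually_singular (pullback n mu) (haar R).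
Proof.
move=> n0 [A [mA A0 muA]]; have mB : measurable (cpow n @^-1` A) by exact: measurable_funPTI.
exists (cpow n @^-1` A); split => //.
  have := push_haar n0 => /(congr1 (fun m : M => m A)).
  by rewrite rpushE// !haarME// => h; exact: etrans h A0.
move=> B mB' BA; rewrite pullbackE rmeasureZ// rmeasure_sum//.
rewrite big1 ?mule0// => k _; rewrite rpushE//; apply: muA.
  exact: measurable_funPTI.
by move=> z /= /BA /=; rewrite cpow_branch.
Qed.

(** The new carrier is the image of [A] under [cpow n], written as a union of preimages under the
    branches so that it is visibly measurable. It is null because [pullback n] fixes Haar
    measure. *)
Lemma singular_push n mu : (0 < n)%N ->
  mutually_singular mu (haar R) -> mutually_singular (push n mu) (haar R).
Proof.
move=> n0 [A [mA A0 muA]].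
have mB k : measurable (branch n k @^-1` A) by exact: measurable_funPTI.
exists (\big[setU/set0]_(k < n) (branch n k @^-1` A)); split.
- exact: bigsetU_measurable.
- apply/eqP; rewrite -measure_le0.
  have B := @Boole_inequality _ _ _ (haar R) (fun k => branch n k @^-1` A) n
    (fun k _ => mB k).
  apply: (le_trans B).
  have := pullback_haar n0 => /(congr1 (fun m : M => m A)).
  rewrite pullbackE rmeasureZ// rmeasure_sum// haarME// A0.
  rewrite (eq_bigr (fun k : 'I_n => haar R (branch n k @^-1` A))); last first.
    by move=> k _; rewrite rpushE//; exact: haarME (mB k).
  move=> /eqP; rewrite mule_eq0 eqe invr_eq0 pnatr_eq0 => /orP[|/eqP ->//].
  by rewrite eqn0Ngt n0.
- move=> B mB' BA; rewrite rpushE//; apply: muA; first exact: measurable_funPTI.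
  move=> z /= Bz Az; apply: (BA _ Bz); rewrite -(bigcup_mkord n (fun k => branch n k @^-1` A)).
  have [k kn zE] := branch_cpow z n0; exists k => //=.
  by rewrite -zE.
Qed.

Lemma M0_push n mu : mu \in M0 R -> push n mu \in M0 R.
Proof. by rewrite !inE push_setT. Qed.

Lemma M0_pullback n mu : (0 < n)%N -> mu \in M0 R -> pullback n mu \in M0 R.
Proof. by move=> n0; rewrite !inE pullback_setT. Qed.

Lemma Mk0_push n mu : (0 < n)%N -> mu \in Mk0 R -> push n mu \in Mk0 R.
Proof.
move=> n0; rewrite !inE => -[s sing ->]; exists (push n s); first exact: singular_push.
by rewrite raddfB /= push_setT /push rpushZ -/(push n (haarM R)) push_haar.
Qed.

Lemma Mk0_pullback n mu : (0 < n)%N -> mu \in Mk0 R -> pullback n mu \in Mk0 R.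
Proof.
move=> n0; rewrite !inE => -[s sing ->]; exists (pullback n s).
  exact: singular_pullback.
by rewrite pullback_is_zmod// pullback_setT// pullbackZ pullback_haar.
Qed.

Lemma Mk0_sub_M0 mu : mu \in Mk0 R -> mu \in M0 R.
Proof.
rewrite !inE => -[s _ ->]; rewrite rmeasureB// rmeasureZ// haarME//.
rewrite probability_setT mule1 fineK ?fin_num_measure// subee//.
exact: fin_num_measure.
Qed.

(** The total masses of the two Jordan parts add up to a bound, which controls all atoms uniformly
    in [atomless_sub_pullV]. *)
Lemma rmeasure_bounded mu : exists K : R,
  forall A, measurable A -> `|fine (mu A)| <= K.
Proof.
pose p := jordan_pos (hahnP mu); pose q := jordan_neg (hahnP mu).
have fin (m : {finite_measure set T -> \bar R}) A : measurable A ->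
    0 <= fine (m A) <= fine (m setT).
  move=> mA; rewrite fine_ge0 ?measure_ge0//= fine_le ?fin_num_measure//.
  by rewrite le_measure ?inE.
exists (fine (p setT) + fine (q setT)) => A mA; rewrite jordan_decompE// fineB ?fin_num_measure//.
have /andP[p0 p1] := fin p A mA; have /andP[q0 q1] := fin q A mA.
rewrite ler_norml; apply/andP; split; rewrite -/p -/q; lra.
Qed.

Lemma branch_inj n k l (z : T) : (k < n)%N -> (l < n)%N ->
  branch n k z = branch n l z -> k = l.
Proof.
move=> kn ln; rewrite [LHS]branchE [RHS]branchE => /(congr1 (@cval R)) h.
apply: (unity_root_inj kn ln); apply: cval_inj.
exact: (mulIf (cval_neq0 (branch n 0 z)) h).
Qed.

(** A branch can take the value [x] only at [cpow n x], and exactly one of the [n] branches does. *)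
Lemma pullback_set1 n mu (x : T) : (0 < n)%N ->
  pullback n mu [set x] = (n%:R^-1%:E * mu [set cpow n x])%E.
Proof.
move=> n0; have mx := measurable_circle_set1 x.
rewrite pullbackE rmeasureZ// rmeasure_sum//; congr (_ * _)%E.
have [k kn xE] := branch_cpow x n0.
rewrite (bigD1 (Ordinal kn))//= big1 ?adde0 => [|l lk]; rewrite rpushE//.
  congr (mu _); apply/seteqP; split=> z /=.
    by move=> /(congr1 (cpow n)); rewrite cpow_branch.
  by move=> ->.
rewrite (_ : _ @^-1` _ = set0) ?charge0//; apply/seteqP; split=> z //= zx.
have zE : cpow n x = z by rewrite -zx cpow_branch.
case/eqP: lk; apply/val_inj/(@branch_inj n _ _ z) => //=.
by rewrite zx -zE.
Qed.

End operator_identities.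

(** * Products of operators of the form 1 - F *)

Section difference_products.
Variables (V : zmodType) (I : eqType) (F : I -> V -> V).

(** Allowing an arbitrary list of indices makes induction possible; [Phi] and [Omega] are the
    instances at the full enumeration. *)
Definition diff_prod (r : seq I) : V -> V :=
  \big[comp/idfun]_(i <- r) (fun x => x - F i x).

Lemma diff_prod_nil x : diff_prod [::] x = x.
Proof. by rewrite /diff_prod big_nil. Qed.

Lemma diff_prod_cons i r x :
  diff_prod (i :: r) x = diff_prod r x - F i (diff_prod r x).
Proof. by rewrite /diff_prod big_cons. Qed.

Lemma diff_prod_comm (X : {additive V -> V}) r x :
  {in r, forall i y, X (F i y) = F i (X y)} -> X (diff_prod r x) = diff_prod r (X x).
Proof.
elim: r => [|i r IH] XF; first by rewrite !diff_prod_nil.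
rewrite !diff_prod_cons raddfB /= XF ?mem_head// IH// => j jr.
by apply: XF; rewrite inE jr orbT.
Qed.

Lemma diff_prod_closed (P : zmodClosed V) r x :
  (forall i y, y \in P -> F i y \in P) -> x \in P -> diff_prod r x \in P.
Proof.
move=> PF Px; elim: r => [|i r IH]; first by rewrite diff_prod_nil.
by rewrite diff_prod_cons rpredB// PF.
Qed.

Hypothesis F_zmod : forall i, zmod_morphism (F i).

Let F0 i : F i 0 = 0. Proof. by rewrite -[in LHS](subrr 0) F_zmod subrr. Qed.

Lemma diff_prod_zmod r : zmod_morphism (diff_prod r).
Proof.
move=> x y; elim: r => [|i r IH]; first by rewrite !diff_prod_nil.
by rewrite !diff_prod_cons IH F_zmod !opprB addrACA [RHS]addrACA; congr (_ + _); rewrite addrC.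
Qed.

(** [Y] moves past the factors with index other than [i] and annihilates [1 - F i]. *)
Lemma diff_prod_kill (Y : {additive V -> V}) i r x : i \in r ->
  (forall y, Y (F i y) = Y y) ->
  (forall j y, j != i -> Y (F j y) = F j (Y y)) -> Y (diff_prod r x) = 0.
Proof.
move=> + Yi Yj; elim: r => [//|j r IH]; rewrite inE diff_prod_cons raddfB /=.
have [<- _|ji /= ir] := eqVneq i j; first by rewrite Yi subrr.
by rewrite Yj 1?eq_sym// IH// F0 subrr.
Qed.

End difference_products.

(** * Subgroups cut out by vanishing Fourier coefficients *)

Section spectral_subgroup.
Variable R : realType.
Local Notation M := (rmeasure (circle R) R).

(** With its subgroup structure, this predicate contains a generated subgroup as soon as it contains
    the generators. *)
Definition fourier_vanish (P : set int) : {pred M} :=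
  [pred mu | `[< forall nu, P nu -> fourier_coef nu mu = 0 >]].

Lemma fourier_vanish_zmod_closed P : zmod_closed (fourier_vanish P).
Proof.
split=> [|x y]; rewrite !inE; first by move=> nu _; rewrite raddf0.
by move=> hx hy nu Pnu; rewrite raddfB /= hx// hy// subrr.
Qed.
HB.instance Definition _ P :=
  GRing.isZmodClosed.Build M (fourier_vanish P) (fourier_vanish_zmod_closed P).

End spectral_subgroup.

(** * Injectivity, atoms, and the kernel and image of [Omega] *)

Section corollary21_lemmas.
Variables (R : realType) (s : nat) (N : 'I_s -> nat).
Local Notation M := (rmeasure (circle R) R).
Variable cM : zmodClosed M.
Hypothesis N2 : forall i, (2 <= N i)%N.
Hypothesis Nco : forall i j, i != j -> coprime (N i) (N j).
Hypothesis cME : cM =i M0 R \/ cM =i Mk0 R.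
Local Notation S := (generated_monoid N).
Implicit Types (mu : M) (i j : 'I_s) (r : seq 'I_s).

Let N0 i : (0 < N i)%N. Proof. exact: ltnW. Qed.

Local Notation pull := (fun i => @pullback R (N i)).
Local Notation avg := (fun i => @average R (N i)).

Let pull_zmod i : zmod_morphism (pull i). Proof. exact: pullback_is_zmod. Qed.

Let avgE i mu : average (N i) mu = pullback (N i) (push (N i) mu).
Proof. by rewrite pullback_push. Qed.

Let avg_zmod i : zmod_morphism (avg i).
Proof. by move=> x y /=; rewrite !avgE raddfB /= pull_zmod. Qed.

Let cM_push n mu : (0 < n)%N -> mu \in cM -> push n mu \in cM.
Proof. by case: cME => cE n0; rewrite !cE; [exact: M0_push|exact: Mk0_push]. Qed.

Let cM_pull n mu : (0 < n)%N -> mu \in cM -> pullback n mu \in cM.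
Proof. by case: cME => cE n0; rewrite !cE; [exact: M0_pullback|exact: Mk0_pullback]. Qed.

Let cM_avg i mu : mu \in cM -> average (N i) mu \in cM.
Proof. by move=> cmu; rewrite avgE cM_pull// cM_push. Qed.

Let cM_setT mu : mu \in cM -> mu setT = 0%E.
Proof.
case: cME => cE; rewrite cE; first by rewrite inE.
by move=> /Mk0_sub_M0; rewrite inE.
Qed.

Lemma generated_monoid_gen i : S (N i).
Proof.
exists (fun j => (j == i) : nat); rewrite (bigD1 i)//= eqxx expn1 big1 ?muln1// => j.
by move=> /negbTE ->.
Qed.

(** A product different from 1 has a nonzero exponent, so one factor [N i] splits off. *)
Lemma generated_monoid_neq1 n : S n -> n <> 1%N ->
  exists i m, (0 < m)%N /\ n = (N i * m)%N.
Proof.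
move=> [nu nE] n1.
have n0 : (0 < n)%N by rewrite nE prodn_gt0// => i; rewrite expn_gt0 N0.
have [i nui] : exists i, nu i != 0%N.
  apply/existsP; apply: contra_notT n1; rewrite negb_exists => /forallP nu0.
  by rewrite nE big1// => i _; have := nu0 i; rewrite negbK => /eqP ->.
exists i, (N i ^ (nu i).-1 * \prod_(j < s | j != i) N j ^ nu j)%N.
have nE' : n = (N i * (N i ^ (nu i).-1 * \prod_(j < s | j != i) N j ^ nu j))%N.
  by rewrite nE (bigD1 i)//= mulnA -expnS prednK// lt0n.
by split=> //; move: n0; rewrite nE' muln_gt0 => /andP[].
Qed.

Lemma push_avg_comm i j mu : j != i ->
  push (N i) (average (N j) mu) = average (N j) (push (N i) mu).
Proof.
move=> ji; rewrite !avgE push_pullbackC// ?Nco 1?eq_sym//.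
by rewrite !push_push mulnC.
Qed.

Lemma push_avg i mu : push (N i) (average (N i) mu) = push (N i) mu.
Proof. by rewrite avgE push_pullback. Qed.

Lemma diff_avg_push_eq0 i r mu : i \in r -> push (N i) (diff_prod avg r mu) = 0.
Proof.
move=> ir.
apply: (@diff_prod_kill _ _ avg avg_zmod (@push R (N i)) i r mu ir) => [y|j y ji].
  exact: push_avg.
exact: push_avg_comm.
Qed.

(** An average is a push-forward followed by a pull-back. Here [push (N i)] commutes with the
    averages over the rest of the list, whose indices differ from [i] by uniqueness, and then fixes
    [mu]. *)
Lemma diff_pull_avg r mu : uniq r -> (forall i, push (N i) mu = mu) ->
  diff_prod pull r mu = diff_prod avg r mu.
Proof.
move=> + pmu; elim: r => [|i r IH]; first by rewrite !diff_prod_nil.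
move=> /= /andP[ir /IH E]; rewrite !diff_prod_cons E; congr (_ - _).
rewrite avgE (diff_prod_comm (X := @push R (N i))) /=.
  by rewrite pmu.
by move=> j jr y /=; apply: push_avg_comm; apply: contraNneq ir => <-.
Qed.

(** Descent on the absolute value of the frequency: a coefficient of [mu = pullback n mu] is 0 or
    equals the one at [nu / n], which is smaller in absolute value when [nu] is nonzero. Frequency 0
    is settled by the total mass. *)
Lemma sub_pull_inj n mu : (1 < n)%N -> mu setT = 0%E -> mu - pullback n mu = 0 -> mu = 0.
Proof.
move=> n1 mu0 /subr0_eq muE; apply: fourier_coef_eq0 => nu.
have n0 : (0 < n)%N by exact: ltnW.
have [k] := ubnP `|nu|%N; elim: k nu => // k IH nu; rewrite ltnS => nuk.
have [->|nu0] := eqVneq nu 0; first by rewrite fourier_coef0 mu0.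
rewrite muE fourier_coef_pullback//; case: ifP => // /dvdzP[q qE].
have nZ : n%:Z != 0 by rewrite eqz_nat -lt0n.
rewrite qE mulzK//; apply: IH; apply: leq_trans nuk.
rewrite qE abszM /= ltn_Pmulr// absz_gt0.
by apply: contraNneq nu0 => q0; rewrite qE q0 mul0r.
Qed.

(** Factors are cancelled one at a time; the partial products stay in [cM] and so have total mass 0,
    as [sub_pull_inj] requires. *)
Lemma diff_pull_inj r mu : mu \in cM -> diff_prod pull r mu = 0 -> mu = 0.
Proof.
move=> cmu; elim: r => [|i r IH]; first by rewrite diff_prod_nil.
rewrite diff_prod_cons => h; apply: IH; apply: sub_pull_inj h => //.
apply: cM_setT; apply: diff_prod_closed cmu => j y cy; exact: cM_pull.
Qed.

Lemma atomless_sub_pull n mu : (0 < n)%N -> atomless mu -> atomless (mu - pullback n mu).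
Proof.
move=> n0 amu x; rewrite rmeasureB ?pullback_set1//; last exact: measurable_circle_set1.
by rewrite !amu mule0 sube0.
Qed.

(** The mass at [z] is the mass at [cpow n z] divided by [n]. Iterating [k] times bounds every atom
    by [K * n%:R^-1 ^+ k], which tends to 0. *)
Lemma atomless_sub_pullV n mu : (1 < n)%N -> atomless (mu - pullback n mu) -> atomless mu.
Proof.
move=> n1 amu x; have n0 : (0 < n)%N by exact: ltnW.
have mE z : fine (mu [set z]) = n%:R^-1 * fine (mu [set cpow n z]).
  have mz := measurable_circle_set1 z; have := amu z.
  rewrite rmeasureB ?pullback_set1//.
  rewrite -(fineK (fin_num_measure mu [set z] mz)).
  rewrite -(fineK (fin_num_measure mu [set cpow n z] (measurable_circle_set1 _))).
  by rewrite -EFinM -EFinB => -[/subr0_eq].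
have [K muK] := rmeasure_bounded mu.
have n01 : 0 <= (n%:R^-1 : R) < 1 by rewrite invr_ge0 ler0n invf_lt1 ?ltr1n// ltr0n.
have bnd k z : `|fine (mu [set z])| <= K * n%:R^-1 ^+ k.
  elim: k z => [|k IH] z.
    by rewrite expr0 mulr1; exact: muK (measurable_circle_set1 z).
  have /andP[a0 _] := n01.
  by rewrite mE normrM ger0_norm// exprS mulrCA ler_wpM2l.
have : K * n%:R^-1 ^+ k @[k --> \oo] --> K * (0 : R).
  apply: cvgMr; apply: cvg_expr; have /andP[a0 a1] := n01; by rewrite ger0_norm.
rewrite mulr0 => lim0.
have : `|fine (mu [set x])| <= 0.
  rewrite -(cvg_lim _ lim0)//; apply: limr_ge; first by apply/cvg_ex; exists 0.
  by near=> k; exact: bnd.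
rewrite normr_le0 => /eqP h.
by rewrite -(fineK (fin_num_measure mu [set x] (measurable_circle_set1 x))) h.
Unshelve. all: by end_near. Qed.

Lemma atomless_diff_pull r mu : atomless mu <-> atomless (diff_prod pull r mu).
Proof.
elim: r => [|i r IH]; first by rewrite diff_prod_nil.
rewrite diff_prod_cons IH; split; [exact: atomless_sub_pull|exact: atomless_sub_pullV].
Qed.

Lemma fourier_coef_diff_avg nu r mu : fourier_coef nu (diff_prod avg r mu) =
  if has (fun i => ((N i)%:Z %| nu)%Z) r then 0 else fourier_coef nu mu.
Proof.
elim: r => [|i r IH]; first by rewrite diff_prod_nil.
rewrite diff_prod_cons raddfB /= fourier_coef_average//.
by case: ifP => /= _; rewrite ?subrr// subr0.
Qed.

Definition off_multiples : set int := [set nu | forall i, ~~ ((N i)%:Z %| nu)%Z].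

Lemma OmegaE : Omega N = diff_prod avg (index_enum 'I_s) :> (M -> M).
Proof. by []. Qed.

Lemma PhiE : Phi N = diff_prod pull (index_enum 'I_s) :> (M -> M).
Proof. by []. Qed.

Lemma Omega_zmod : zmod_morphism (@Omega R s N).
Proof. exact: diff_prod_zmod. Qed.

(** On Fourier coefficients [Omega] is multiplication by the indicator of [off_multiples]. *)
Lemma Omega_eq0 mu : Omega N mu = 0 <-> mu \in fourier_vanish off_multiples.
Proof.
rewrite OmegaE; split.
  move=> O0; rewrite inE => nu nuN; have := fourier_coef_diff_avg nu (index_enum 'I_s) mu.
  rewrite O0 raddf0; case: hasP => [[i _]|_ <-//].
  by rewrite (negbTE (nuN i)).
rewrite inE => mu0; apply: fourier_coef_eq0 => nu; rewrite fourier_coef_diff_avg.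
case: hasP => // nuN; apply: mu0 => i; apply/negP => Ni; apply: nuN.
by exists i => //; exact: mem_index_enum.
Qed.

Lemma MS_cM mu : mu \in MS S cM -> mu \in cM.
Proof.
rewrite inE; apply=> _ [n [m [Sn n1 cm ->]]]; apply: cM_pull => //.
by have [i [k [k0 ->]]] := generated_monoid_neq1 Sn n1; rewrite muln_gt0 N0.
Qed.

(** It suffices to treat a generator [pullback n m]: its coefficients are supported on the multiples
    of [n], hence on those of some [N i]. *)
Lemma MS_Omega mu : mu \in MS S cM -> Omega N mu = 0.
Proof.
move=> muMS; apply/Omega_eq0; move: muMS; rewrite inE; apply=> _ [n [m [Sn n1 cm ->]]].
have [i [k [k0 nE]]] := generated_monoid_neq1 Sn n1.
rewrite inE => nu nuN; rewrite fourier_coef_pullback; last by rewrite nE muln_gt0 N0.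
case: ifPn => // nnu; case/negP: (nuN i); apply: dvdz_trans nnu.
by rewrite nE PoszM dvdz_mulr.
Qed.

(** Telescoping: the factor of index [i] adds to the difference the average of the remaining product
    [y], which is the pull-back of [push (N i) y] and so a generator of [MS]. *)
Lemma sub_Omega_MS mu : mu \in cM -> mu - Omega N mu \in MS S cM.
Proof.
move=> cmu; rewrite OmegaE; elim: (index_enum _) => [|i r IH].
  by rewrite diff_prod_nil subrr rpred0.
rewrite diff_prod_cons opprB addrCA rpredD//.
rewrite inE => A GA; apply: GA; exists (N i), (push (N i) (diff_prod avg r mu)).
split; [exact: generated_monoid_gen| | |by rewrite -avgE].
  by move=> Ni; have := N2 i; rewrite Ni.
by apply: cM_push => //; apply: diff_prod_closed cmu => j y; exact: cM_avg.
Qed.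

(** Both sides describe the kernel of [Omega] on [cM]: [Omega] kills [MS], and [mu - Omega N mu]
    always lies in [MS]. *)
Lemma MS_P mu : mu \in MS S cM <->
  mu \in cM /\ mu \in fourier_vanish off_multiples.
Proof.
split=> [muMS|[cmu /Omega_eq0 O0]].
  by split; [exact: MS_cM|apply/Omega_eq0/MS_Omega].
by rewrite -[mu]subr0 -O0; exact: sub_Omega_MS.
Qed.

Lemma push_eq0 mu : (forall i, push (N i) mu = 0) ->
  forall n, S n -> n <> 1%N -> push n mu = 0.
Proof.
move=> p0 n Sn n1; have [i [m [_ ->]]] := generated_monoid_neq1 Sn n1.
by rewrite mulnC -push_push p0 raddf0.
Qed.

Lemma Omega_ZS mu : mu \in cM -> Omega N mu \in ZS S cM.
Proof.
move=> cmu; rewrite inE OmegaE (diff_prod_closed _ cM_avg)//=.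
apply/asboolP/push_eq0 => i; apply: diff_avg_push_eq0; exact: mem_index_enum.
Qed.

(** Every [push (N i)] kills [mu], hence so does every average, and each factor acts as the
    identity. *)
Lemma Omega_id mu : mu \in ZS S cM -> Omega N mu = mu.
Proof.
rewrite inE OmegaE => /andP[_ /asboolP p0]; elim: (index_enum _) => [|i r IH].
  by rewrite diff_prod_nil.
rewrite diff_prod_cons IH avgE p0 ?raddf0.
- by have := pull_zmod i 0 0; rewrite !subrr => ->; rewrite subr0.
- exact: generated_monoid_gen.
- by move=> Ni; have := N2 i; rewrite Ni.
Qed.

Lemma Phi_Omega mu : mu \in H0S S cM -> Phi N mu = Omega N mu.
Proof.
rewrite inE => /andP[_ /asboolP pmu]; rewrite PhiE OmegaE diff_pull_avg//.
- exact: index_enum_uniq.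
- move=> i; apply: pmu; exact: generated_monoid_gen.
Qed.

Lemma Phi_inj : {in H0S S cM &, injective (Phi N)}.
Proof.
move=> x y; rewrite !inE => /andP[cx _] /andP[cy _] /eqP.
rewrite -subr_eq0 PhiE -diff_prod_zmod// => /eqP/diff_pull_inj => h.
by apply/eqP; rewrite -subr_eq0 h// rpredB.
Qed.

End corollary21_lemmas.

(** * Cosets modulo the subgroup [MS] *)

Section quotient.
Variables (R : realType) (S : set nat) (cM : zmodClosed (rmeasure (circle R) R)).

Lemma coset_MS_eq (x y : subgroup cM) :
  coset_MS S x = coset_MS S y <-> sg_val x - sg_val y \in MS S cM.
Proof.
have -> : (sg_val x - sg_val y \in MS S cM) = (x - y \in relsub cM (MS S cM)).
  by rewrite -[sg_val x]/(val x) -[sg_val y]/(val y) -raddfB.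
rewrite Quotient.idealrBE; split=> [h|/eqP//]; exact/eqP.
Qed.

Lemma coset_MS_repr (q : MmodMS S cM) : coset_MS S (repr q) = q.
Proof. exact: reprK. Qed.

Lemma coset_MSB : zmod_morphism (@coset_MS R S cM).
Proof. by move=> x y; rewrite /coset_MS; exact: raddfB. Qed.

End quotient.

(** * Properties of [Phi] and the isomorphism given by [Omega] *)

Theorem corollary21 (R : realType) (s : nat) (N : 'I_s -> nat)
    (cM : zmodClosed (rmeasure (circle R) R)) :
  (0 < s)%N -> (forall i, 2 <= N i)%N ->
  (forall i j, i != j -> coprime (N i) (N j)) ->
  cM =i M0 R \/ cM =i Mk0 R ->
  let S := generated_monoid N in
  [/\ (forall mu, mu \in H0S S cM -> Phi N mu \in ZS S cM) /\
        {in H0S S cM &, injective (Phi N)},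
      forall mu, mu \in H0S S cM -> Phi N mu = Omega N mu,
      forall mu, mu \in H0S S cM -> (atomless mu <-> atomless (Phi N mu)),
      exists Psi : {additive MmodMS S cM -> subgroup (ZS S cM)},
        [/\ cancel (fun z : subgroup (ZS S cM) => coset_MS S (ZS_incl z)) Psi,
            cancel Psi (fun z : subgroup (ZS S cM) => coset_MS S (ZS_incl z)) &
            forall mu : subgroup cM,
              sg_val (Psi (coset_MS S mu)) = Omega N (sg_val mu)]
    & forall mu, mu \in MS S cM <->
        mu \in cM /\
        forall nu : int, (forall i, ~~ ((N i)%:Z %| nu)%Z) ->
          fourier_coef nu mu = 0].
Proof.
move=> _ N2 Nco cME S.
have PhiO mu : mu \in H0S S cM -> Phi N mu = Omega N mu by exact: Phi_Omega.
have OZ mu : mu \in cM -> Omega N mu \in ZS S cM by exact: Omega_ZS.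
have ZO mu : mu \in ZS S cM -> Omega N mu = mu by exact: Omega_id.
have OB : zmod_morphism (@Omega R s N) by exact: Omega_zmod.
have OMS mu : mu \in MS S cM -> Omega N mu = 0 by exact: MS_Omega.
have subMS mu : mu \in cM -> mu - Omega N mu \in MS S cM by exact: sub_Omega_MS.
split.
- split=> [mu muH|]; last exact: Phi_inj.
  by rewrite PhiO//; apply: OZ; case/andP: muH.
- exact: PhiO.
- by move=> mu _; apply: atomless_diff_pull.
(* The inverse applies [Omega] to a chosen representative; [psiE] shows that the choice is
   immaterial, since [Omega] kills [MS]. *)
- pose psi (q : MmodMS S cM) : subgroup (ZS S cM) :=
    Subgroup (OZ (sg_val (repr q)) (valP (repr q))).
  have psiE (x : subgroup cM) : sg_val (psi (coset_MS S x)) = Omega N (sg_val x).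
    apply/eqP; rewrite -subr_eq0 /= -OB; apply/eqP/OMS.
    by apply/coset_MS_eq; rewrite coset_MS_repr.
  have psi_zmod : zmod_morphism psi.
    move=> p q; rewrite -(coset_MS_repr p) -(coset_MS_repr q) -coset_MSB.
    apply: val_inj; rewrite [RHS]raddfB; apply: etrans (psiE _) _.
    have -> : sg_val (repr p - repr q) = sg_val (repr p) - sg_val (repr q).
      exact: (raddfB val).
    by rewrite OB; congr (_ - _); apply/esym/psiE.
  pose Psi : {additive MmodMS S cM -> subgroup (ZS S cM)} :=
    HB.pack psi (GRing.isZmodMorphism.Build _ _ psi psi_zmod).
  exists Psi; split=> [z|q|x]; last exact: psiE.
    by apply: val_inj; apply: etrans (psiE _) _; exact: ZO (valP z).
  (* A representative and its image under [Omega] differ by an element of [MS], so they have the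
     same coset. *)
  rewrite -[RHS]coset_MS_repr; apply/coset_MS_eq => /=.
  by rewrite -opprB rpredN; exact: subMS (valP (repr q)).
- move=> mu; split=> [/(MS_P N2 cME)[cmu]|[cmu h]].
    by rewrite inE.
  by apply/(MS_P N2 cME); rewrite inE.
Qed.
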